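(* For every $\lambda>0$ and $d\ge0$ there exists a collection $\{f^{(\lambda)}_{d,\beta}\}_{\beta\in\mathcal{X}_d}$ of functions $f^{(\lambda)}_{d,\beta}:\mathcal{X}_d\to\mathbb{R}$, not depending on $s$, such that for every $s\in[0,1]$, $$\forall t,t'\in\mathcal{X}_d,\quad L_d(t,t')=\sum_{\beta\in\mathcal{X}_d}s^{|\beta|-1}f^{(\lambda)}_{d,\beta}(t)f^{(\lambda)}_{d,\beta}(t'),$$ and moreover: (1) $f^{(\lambda)}_{d,\bullet}(t)=1$ for all $t\in\mathcal{X}_d$; (2) for all $\beta,\beta'\in\mathcal{X}_d$, $\sum_{t\in\mathcal{X}_d}\mathrm{GW}^{(\lambda)}_d(t)f^{(\lambda)}_{d,\beta}(t)f^{(\lambda)}_{d,\beta'}(t)=\mathbf{1}_{\beta=\beta'}$; (3) for all $t,t'\in\mathcal{X}_d$, $\sum_{\beta\in\mathcal{X}_d}f^{(\lambda)}_{d,\beta}(t)f^{(\lambda)}_{d,\beta}(t')=\mathbf{1}_{t=t'}/\mathrm{GW}^{(\lambda)}_d(t)$; (4) for all $n\ge2$, $d\ge1$ and $\beta^{(1)}=\{\beta^{(1)}_\gamma\}_{\gamma\in\mathcal{X}_{d-1}},\dots,\beta^{(n)}=\{\beta^{(n)}_\gamma\}_{\gamma\in\mathcal{X}_{d-1}}\in\mathcal{X}_d$, $$\sum_{t\in\mathcal{X}_d}\mathrm{GW}^{(\lambda)}_d(t)f^{(\lambda)}_{d,\beta^{(1)}}(t)\cdots f^{(\lambda)}_{d,\beta^{(n)}}(t)\xrightarrow[\lambda\to\infty]{}\prod_{\gamma\in\mathcal{X}_{d-1}}\sqrt{\prod_{i=1}^n\beta^{(i)}_\gamma!}\,\Big[x_1^{\beta^{(1)}_\gamma}\cdots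 x_n^{\beta^{(n)}_\gamma}\Big]\exp\Big(\sum_{1\le i<j\le n}x_ix_j\Big).$$
   Context: Rooted unlabeled trees: $\mathcal{X}_0=\{\bullet\}$ consists of the trivial tree. For $d\ge1$, an element $t\in\mathcal{X}_d$ is a family $t=\{N_\tau\}_{\tau\in\mathcal{X}_{d-1}}$ of non-negative integers with finite support ($N_\tau$ is the number of children of the root whose subtree is $\tau$). The size is $|\bullet|=1$ and $|t|=1+\sum_\tau N_\tau|\tau|$. Galton–Watson law: for $\mu>0$, $\mathrm{GW}^{(\mu)}_0$ is the Dirac mass at $\bullet$, and for $d\ge1$, $t=\{N_\tau\}\sim \mathrm{GW}^{(\mu)}_d$ means the $N_\tau$ are independent with $N_\tau\sim\mathrm{Poisson}(\mu\,\mathrm{GW}^{(\mu)}_{d-1}(\tau))$. Null model: $\mathbb{P}^{(\lambda,0)}_d=\mathrm{GW}^{(\lambda)}_d\otimes\mathrm{GW}^{(\lambda)}_d$. Correlated model $\mathbb{P}^{(\lambda,s)}_d$ ($\lambda>0$, $s\in[0,1]$): $\mathbb{P}^{(\lambda,s)}_0$ is the Dirac mass at $(\bullet,\bullet)$; for $d\ge1$, $(t,t')\sim\mathbb{P}^{(\lambda,s)}_d$ is sampled as $N_\tau=\Delta_\tau+\sum_{\tau'}M_{\tau,\tau'}$, $N'_{\tau'}=\Delta'_{\tau'}+\sum_{\tau}M_{\tau,\tau'}$, with all $\Delta_\tau,\Delta'_\tau,M_{\tau,\tau'}$ independent Poisson with parameters $\lambda(1-s)\mathrm{GW}^{(\lambda)}_{d-1}(\tau)$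 for $\Delta_\tau,\Delta'_\tau$ and $\lambda s\,\mathbb{P}^{(\lambda,s)}_{d-1}(\tau,\tau')$ for $M_{\tau,\tau'}$. Likelihood ratio: $L_d(t,t')=\mathbb{P}^{(\lambda,s)}_d(t,t')/\mathbb{P}^{(\lambda,0)}_d(t,t')$. For a formal power series $f$ in variables $x_1,\dots,x_n$, $[x_1^{m_1}\cdots x_n^{m_n}]f$ denotes the coefficient of that monomial. In (4), only finitely many $\gamma$ have some $\beta^{(i)}_\gamma\neq0$, and the factors for the other $\gamma$ equal $1$. *)

(* Defs.v *)
From Stdlib Require Import Reals.
From HB Require Import structures.
From mathcomp Require Import all_boot all_order all_algebra.
From mathcomp Require Import finmap mpoly.

Set Implicit Arguments.
Unset Strict Implicit.
Unset Printing Implicit Defensive.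

Local Open Scope fset_scope.
Local Open Scope R_scope.

(* Rooted unlabeled trees of depth <= d:  X 0 = {bullet},                     *)
(* X (d+1) = finitely supported families {N_tau}_{tau in X d} of naturals.    *)
Fixpoint X (d : nat) : countType :=
  match d with
  | 0 => unit
  | d'.+1 => {fsfun X d' -> nat with 0%N}
  end.

Definition bullet (d : nat) : X d :=
  match d return X d with
  | 0 => tt
  | d'.+1 => ([fsfun for fun _ : X d' => 0%N] : {fsfun X d' -> nat with 0%N})
  end.

Fixpoint tree_size (d : nat) : X d -> nat :=
  match d return X d -> nat with
  | 0 => fun _ => 1%N
  | d'.+1 => fun t => (\sum_(a <- finsupp t) t a * tree_size a)%N.+1
  end.

Notation "\rsum_ ( i <- r ) F" := (\big[Rplus/R0]_(i <- r) F)
  (at level 41, F at level 41, i, r at level 50).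
Notation "\rsum_ ( i : T | P ) F" := (\big[Rplus/R0]_(i : T | P) F)
  (at level 41, F at level 41, i at level 50).
Notation "\rsum_ ( i < n ) F" := (\big[Rplus/R0]_(i < n) F)
  (at level 41, F at level 41, i, n at level 50).
Notation "\rprod_ ( i <- r ) F" := (\big[Rmult/R1]_(i <- r) F)
  (at level 36, F at level 36, i, r at level 50).
Notation "\rprod_ ( i : T ) F" := (\big[Rmult/R1]_(i : T) F)
  (at level 36, F at level 36, i at level 50).
Notation "\rprod_ ( i < n ) F" := (\big[Rmult/R1]_(i < n) F)
  (at level 36, F at level 36, i, n at level 50).

(* Poisson weight without its exponential factor: mu^k / k! *)
Definition pw (mu : R) (k : nat) : R := mu ^ k / INR (factorial k).

(* Galton-Watson law GW^(mu)_d as a probability mass function on X d.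
   For d >= 1 the N_tau are independent Poisson(mu GW_{d-1}(tau)); the
   probability of a finitely supported family is
     prod_{tau in supp} e^{-mu GW(tau)} (mu GW(tau))^{N_tau}/N_tau!
     * prod_{tau notin supp} e^{-mu GW(tau)}
   and the exponential factors multiply to e^{-mu sum_tau GW_{d-1}(tau)}
   = e^{-mu}, GW_{d-1} being a probability distribution. *)
Fixpoint GW (mu : R) (d : nat) : X d -> R :=
  match d return X d -> R with
  | 0 => fun _ => R1
  | d'.+1 => fun t =>
      exp (- mu) * \rprod_(a <- finsupp t) pw (mu * GW mu a) (t a)
  end.

(* Correlated model P^(lam,s)_d as a probability mass function on X d * X d.
   For d >= 1: N_tau = Delta_tau + sum_tau' M_{tau,tau'},
               N'_tau' = Delta'_tau' + sum_tau M_{tau,tau'},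
   Delta_tau, Delta'_tau ~ Poisson(lam (1-s) GW_{d-1}(tau)),
   M_{tau,tau'} ~ Poisson(lam s P_{d-1}(tau,tau')), all independent.
   P_d(t,t') is the sum, over all matrices M compatible with (t,t')
   (necessarily supported on supp t x supp t', entries <= sum_tau N_tau),
   of the probability of (M, Delta = N - rowsums M, Delta' = N' - colsums M).
   The exponential factors over all indices multiply to
   e^{-lam(1-s)} e^{-lam(1-s)} e^{-lam s} = e^{-lam(2-s)}. *)
Fixpoint Pcor (lam s : R) (d : nat) : X d -> X d -> R :=
  match d return X d -> X d -> R with
  | 0 => fun _ _ => R1
  | d'.+1 => fun t t' =>
      let A := finsupp t in
      let B := finsupp t' in
      let K := (\sum_(a <- A) t a)%N in
      let row (M : {ffun A * B -> 'I_K.+1}) (a : A) :=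
        (\sum_(b : B) (M (a, b) : nat))%N in
      let col (M : {ffun A * B -> 'I_K.+1}) (b : B) :=
        (\sum_(a : A) (M (a, b) : nat))%N in
      exp (- (lam * (2 - s))) *
       \rsum_(M : {ffun A * B -> 'I_K.+1} |
                [forall a : A, (row M a <= t (val a))%N] &&
                [forall b : B, (col M b <= t' (val b))%N])
         ((\rprod_(p : A * B) pw (lam * s * Pcor lam s (val p.1) (val p.2)) (M p)) *
          (\rprod_(a : A) pw (lam * (1 - s) * GW lam (val a)) (t (val a) - row M a)%N) *
          (\rprod_(b : B) pw (lam * (1 - s) * GW lam (val b)) (t' (val b) - col M b)%N))
  end.

(* Likelihood ratio L_d = P^(lam,s)_d / P^(lam,0)_d, with the null model
   P^(lam,0)_d = GW^(lam)_d (x) GW^(lam)_d. *)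
Definition Lratio (lam s : R) (d : nat) (t t' : X d) : R :=
  Pcor lam s t t' / (GW lam t * GW lam t').

(* Unordered (hence absolutely convergent) sum over the countable set X d:
   [HasSum a S] iff the net of finite partial sums converges to S. *)
Definition HasSum (d : nat) (a : X d -> R) (S : R) : Prop :=
  forall eps : R, 0 < eps ->
    exists s0 : seq (X d), forall s : seq (X d), uniq s ->
      {subset s0 <= s} -> Rabs (\rsum_(x <- s) a x - S) < eps.

Definition lim_pinfty (g : R -> R) (l : R) : Prop :=
  forall eps : R, 0 < eps ->
    exists M : R, forall lam : R, M <= lam -> Rabs (g lam - l) < eps.

(* Coefficient extraction [x_1^{m_1} ... x_n^{m_n}] exp(sum_{i<j} x_i x_j).
   exp(Q) = sum_k Q^k / k!; since Q has no constant term, Q^k only has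
   monomials of total degree >= k, so only k <= |m| contribute. *)
Definition intR (z : int) : R :=
  match z with Posz k => INR k | Negz k => - INR k.+1 end.

Section QpolyDef.
Local Open Scope ring_scope.
Definition Qpoly (n : nat) : {mpoly int[n]} :=
  \sum_(i < n) \sum_(j < n | (i < j)%N) 'X_i * 'X_j.
Definition Qcoef (n k : nat) (m : 'I_n -> nat) : int :=
  (Qpoly n ^+ k)@_[multinom m i | i < n].
End QpolyDef.

Definition exp_coef (n : nat) (m : 'I_n -> nat) : R :=
  \rsum_(k < (\sum_(i < n) m i)%N.+1) (intR (Qcoef k m) / INR (factorial k)).

(* the (finite) set of gamma in X d with beta^(i)_gamma <> 0 for some i;
   for every other gamma the factor in (4) equals 1 *)
Definition supp_union (n d : nat) (beta : 'I_n -> X d.+1) : seq (X d) :=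
  undup (flatten [seq (finsupp (beta i) : seq (X d)) | i <- enum 'I_n]).

(* Main.v *)
(** The functions f_(d,b) are multivariate Poisson-Charlier polynomials, built by
    recursion on the depth: if (f_g) is the orthonormal basis at depth d, then at depth
    d+1 the unnormalised functions e_b = sqrt(b!) f_b have the generating function
      sum_b x^b/b! e_b(N)
        = exp(- sqrt lam x_bullet) prod_tau (1 + lam^(-1/2) sum_g x_g f_g(tau))^(N_tau).
    Everything follows from two first-order recursions: a creation rule for e_b when a
    subtree is added to N, and the dual annihilation rule for e_(b + 1_g) at fixed N.
    - Summing over b, they give K(N + 1_tau, N') = (1 - s) K(N, N')
      + lam^-1 sum_tau' N'_tau' s L(tau, tau') K(N, N' - 1_tau') for the kernel K of the
      expansion.  The likelihood ratio satisfies the same recursion, since the new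
      subtree is either unmatched or matched with one of the subtrees of N'; at s = 1 so
      does 1_(N = N') / GW(N).
    - Summing over N, they combine with the Mecke formula for Poisson families into a
      recursion for the moments of products of the e_b.  It gives orthogonality, and as
      lam -> oo only the pairings survive, which is the recursion satisfied by the
      coefficients of exp(sum_(i<j) x_i x_j). *)
Require Import Defs.
From Stdlib Require Import Reals ClassicalEpsilon FunctionalExtensionality.
From HB Require Import structures.
From mathcomp Require Import all_boot all_order all_algebra.
From mathcomp Require Import finmap mpoly.
From mathcomp Require Import Rstruct.
From mathcomp Require Import ring lra zify.
Set Implicit Arguments.
Unset Strict Implicit.
Unset Printing Implicit Defensive.
Import Order.TTheory GRing.Theory Num.Theory.
Local Open Scope ring_scope.
Bind Scope ring_scope with R.

(** * Unordered sums *)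

Section UnorderedSums.
Implicit Types I J : eqType.

(** [HasSum] over an arbitrary index type, since sums over pairs, naturals and families are needed
    as well. Convergence along the net of finite sets amounts, for real terms, to absolute
    convergence. *)
Definition has_sum I (a : I -> R) (S : R) : Prop :=
  forall eps : R, 0 < eps -> exists s0 : seq I, forall s : seq I,
    uniq s -> {subset s0 <= s} -> `|\sum_(x <- s) a x - S| < eps.

Definition summable I (a : I -> R) : Prop := exists S, has_sum a S.

Definition tsum I (a : I -> R) : R := ClassicalEpsilon.epsilon (inhabits 0) (has_sum a).

Lemma tsumP I (a : I -> R) : summable a -> has_sum a (tsum a).
Proof. exact: ClassicalEpsilon.epsilon_spec. Qed.

Lemma subset_undup_catl I (r s : seq I) : {subset r <= undup (r ++ s)}.
Proof. by move=> x xr; rewrite mem_undup mem_cat xr. Qed.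

Lemma subset_undup_catr I (r s : seq I) : {subset s <= undup (r ++ s)}.
Proof. by move=> x xs; rewrite mem_undup mem_cat xs orbT. Qed.

Lemma sum_subset_eq I (a : I -> R) (r s : seq I) :
  uniq r -> uniq s -> {subset r <= s} ->
  \sum_(x <- s | x \in r) a x = \sum_(x <- r) a x.
Proof.
move=> ur us rs; rewrite -big_filter; apply/perm_big/uniq_perm => // [|x].
  by rewrite filter_uniq.
by rewrite mem_filter; apply: andb_idr; apply: rs.
Qed.

Lemma sum_subset_le I (a : I -> R) (r s : seq I) : (forall x, 0 <= a x) ->
  uniq r -> uniq s -> {subset r <= s} -> \sum_(x <- r) a x <= \sum_(x <- s) a x.
Proof.
move=> a0 ur us rs.
by rewrite [leRHS](bigID (mem r)) /= sum_subset_eq // lerDl sumr_ge0.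
Qed.

Lemma has_sum_unique I (a : I -> R) S S' : has_sum a S -> has_sum a S' -> S = S'.
Proof.
move=> hS hS'; apply/eqP/negPn/negP=> neq.
have e0 : 0 < `|S - S'| / 2 by rewrite divr_gt0 // normr_gt0 subr_eq0.
have [r hr] := hS _ e0; have [r' hr'] := hS' _ e0.
have h := hr _ (undup_uniq _) (@subset_undup_catl _ r r').
have h' := hr' _ (undup_uniq _) (@subset_undup_catr _ r r').
move: h h'; set s := \sum_(_ <- _) _ => h h'.
have : `|S - S'| <= `|s - S'| + `|s - S|.
  by have -> : S - S' = (s - S') - (s - S) by [ring]; exact: ler_normB.
lra.
Qed.

Lemma tsumE I (a : I -> R) S : has_sum a S -> tsum a = S.
Proof. by move=> h; exact: (has_sum_unique (tsumP (ex_intro _ S h)) h). Qed.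

Lemma eq_has_sum I (a b : I -> R) S : a =1 b -> has_sum a S -> has_sum b S.
Proof.
move=> ab h e e0; have [s0 h0] := h e e0; exists s0 => s us ss.
by rewrite -(eq_bigr _ (fun x _ => ab x)); apply: h0.
Qed.

Lemma has_sumD I (a b : I -> R) S T :
  has_sum a S -> has_sum b T -> has_sum (fun x => a x + b x) (S + T).
Proof.
move=> ha hb e e0; have e20 : 0 < e / 2 by rewrite divr_gt0.
have [r hr] := ha _ e20; have [r' hr'] := hb _ e20.
exists (r ++ r') => s us ss.
have h := hr s us (fun x xr => ss x (mem_subseq (prefix_subseq _ _) xr)).
have h' := hr' s us (fun x xr => ss x (mem_subseq (suffix_subseq _ _) xr)).
rewrite big_split /= opprD addrACA.
by rewrite (le_lt_trans (ler_normD _ _)) //; lra.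
Qed.

Lemma has_sumZ I (a : I -> R) S c : has_sum a S -> has_sum (fun x => c * a x) (c * S).
Proof.
move=> ha e e0; have c0 : 0 < `|c| + 1 by rewrite ltr_wpDl.
have [r hr] := ha _ (divr_gt0 e0 c0).
exists r => s us ss; have := hr s us ss.
rewrite -mulr_sumr -mulrBr normrM ltr_pdivlMr // mulrC => h.
by apply: le_lt_trans h; rewrite ler_wpM2r // lerDl.
Qed.

Lemma has_sum_fin I (a : I -> R) (r : seq I) :
  uniq r -> (forall x, x \notin r -> a x = 0) -> has_sum a (\sum_(x <- r) a x).
Proof.
move=> ur hr e e0; exists r => s us rs.
suff -> : \sum_(x <- s) a x = \sum_(x <- r) a x by rewrite subrr normr0.
rewrite (bigID (mem r)) /= [X in _ + X]big1 ?addr0; last by move=> x /hr.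
exact: sum_subset_eq.
Qed.

Lemma has_sum0 I : has_sum (fun _ : I => 0) 0.
Proof. by have := @has_sum_fin I (fun=> 0) [::] isT (fun _ _ => erefl); rewrite big_nil. Qed.

Lemma has_sum_fintype (J : finType) (a : J -> R) : has_sum a (\sum_(x : J) a x).
Proof. by apply: has_sum_fin (index_enum_uniq _) _ => x; rewrite mem_index_enum. Qed.

Lemma has_sum_sum I (K : eqType) (r : seq K) (a : K -> I -> R) (S : K -> R) :
  (forall k, k \in r -> has_sum (a k) (S k)) ->
  has_sum (fun x => \sum_(k <- r) a k x) (\sum_(k <- r) S k).
Proof.
elim: r => [|k r IH] h.
  by rewrite big_nil; apply: eq_has_sum (has_sum0 I) => x; rewrite big_nil.
rewrite big_cons; apply: eq_has_sum (has_sumD (h k (mem_head _ _)) (IH _)) => [x|j jr].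
  by rewrite big_cons.
by apply: h; rewrite inE jr orbT.
Qed.

(** Choose [r] past which partial sums are within 1 of [S]. A finite sum off [r] is a difference of
    two such partial sums, hence at most 2 in absolute value; applying this separately to the
    nonnegative and the negative terms gives the 4. *)
Lemma has_sum_abs_bounded I (a : I -> R) S : has_sum a S ->
  exists B, forall s, uniq s -> \sum_(x <- s) `|a x| <= B.
Proof.
move=> ha; have [r0 hr0] := ha _ (@ltr01 R).
set r := undup r0; have ur : uniq r := undup_uniq _.
have bd P s : uniq s -> (forall x, x \in s -> x \notin r) ->
    `|\sum_(x <- s | P x) a x| <= 2.
  move=> us dis; rewrite -big_filter.
  have h1 := hr0 r ur (fun x xr => etrans (mem_undup _ _) xr).
  have h2 : `|\sum_(x <- r ++ filter P s) a x - S| < 1.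
    apply: hr0 => [|x xr]; last by rewrite mem_cat mem_undup xr.
    rewrite cat_uniq ur filter_uniq // andbT; apply/hasPn => x.
    by rewrite mem_filter => /andP[_]; exact: dis.
  move: h1 h2; rewrite big_cat /=; set u := \sum_(_ <- _) _; set v := \sum_(_ <- _) _.
  move=> h1 h2; have -> : v = (u + v - S) - (u - S) by ring.
  by rewrite (le_trans (ler_normB _ _)) //; lra.
exists (\sum_(x <- r) `|a x| + 4) => s us.
rewrite (bigID (mem r)) /= lerD //.
  rewrite -big_filter.
  have -> : \sum_(x <- [seq x <- s | x \in r]) `|a x| =
            \sum_(x <- r | x \in s) `|a x|.
    rewrite -[RHS]big_filter; apply/perm_big/uniq_perm; rewrite ?filter_uniq // => x.
    by rewrite !mem_filter andbC.
  by rewrite [leRHS](bigID (mem s)) /= lerDl sumr_ge0.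
rewrite -big_filter; set t := filter _ _.
have ut : uniq t by rewrite filter_uniq.
have dt x : x \in t -> x \notin r by rewrite mem_filter => /andP[].
rewrite (bigID (fun x => 0 <= a x)) /=.
have -> : \sum_(x <- t | 0 <= a x) `|a x| = \sum_(x <- t | 0 <= a x) a x.
  by apply: eq_bigr => x /ger0_norm.
have -> : \sum_(x <- t | ~~ (0 <= a x)) `|a x| = - \sum_(x <- t | ~~ (0 <= a x)) a x.
  by rewrite -sumrN; apply: eq_bigr => x; rewrite -ltNge => /ltr0_norm.
have := bd (fun x => 0 <= a x) t ut dt.
have := bd (fun x => ~~ (0 <= a x)) t ut dt.
rewrite !ler_norml => /andP[? ?] /andP[? ?]; lra.
Qed.

Lemma has_sum_nonneg_bounded I (a : I -> R) B : (forall x, 0 <= a x) ->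
  (forall s, uniq s -> \sum_(x <- s) a x <= B) -> summable a.
Proof.
move=> a0 aB; pose E y := exists2 s : seq I, uniq s & y = \sum_(x <- s) a x.
have [||S [ubS lubS]] := completeness E.
- by exists B => y [s us ->]; apply/RleP/aB.
- by exists 0, [::]; rewrite ?big_nil.
exists S => e e0.
have [s0 us0 hs0] : exists2 s0 : seq I, uniq s0 & S - e < \sum_(x <- s0) a x.
  apply: NNPP => hn; have /lubS/RleP : is_upper_bound E (S - e).
    move=> y [s us ->]; apply/RleP; rewrite leNgt; apply/negP => lt_s.
    by apply: hn; exists s.
  by lra.
exists s0 => s us ss0.
have : \sum_(x <- s) a x <= S by apply/RleP/ubS; exists s.
have := sum_subset_le a0 us0 us ss0.
move=> h1 h2; rewrite distrC ger0_norm; lra.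
Qed.

(** [a] is the difference of the nonnegative families [|a| + a] and [|a|]. *)
Lemma summable_abs_bounded I (a : I -> R) B :
  (forall s, uniq s -> \sum_(x <- s) `|a x| <= B) -> summable a.
Proof.
move=> aB.
have [S hS] := has_sum_nonneg_bounded (fun x => normr_ge0 (a x)) aB.
have [||T hT] := @has_sum_nonneg_bounded I (fun x => `|a x| + a x) (2 * B).
- by move=> x; rewrite -lerBlDl sub0r lerNl -normrN ler_norm.
- move=> s us; rewrite (le_trans _ (_ : \sum_(x <- s) 2 * `|a x| <= _)) //.
    by apply: ler_sum => x _; have := ler_norm (a x); lra.
  by rewrite -mulr_sumr ler_wpM2l ?aB.
exists (T + -1 * S); apply: eq_has_sum (has_sumD hT (has_sumZ (-1) hS)) => x; ring.
Qed.

(** A finite set [t] of indices [j] involves finitely many sections, so one finite [u] approximates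
    them all, and the rectangle of [u] and [t] can be enlarged to contain [s0]. *)
Lemma has_sum_fubini I J (a : I * J -> R) S (b : J -> R) :
  has_sum a S -> (forall j, has_sum (fun i => a (i, j)) (b j)) -> has_sum b S.
Proof.
move=> hS hb e e0; have e20 : 0 < e / 2 by rewrite divr_gt0.
have [s0 hs0] := hS _ e20.
exists (map snd s0) => t ut st.
have {hb} unif d : 0 < d -> exists u0 : seq I, forall u, uniq u -> {subset u0 <= u} ->
    \sum_(j <- t) `|\sum_(i <- u) a (i, j) - b j| <= (size t)%:R * d.
  move=> d0; elim: t {ut st} => [|j t [u0 IH]].
    by exists [::] => u _ _; rewrite big_nil mul0r.
  have [u1 h1] := hb j _ d0; exists (u0 ++ u1) => u uu su.
  rewrite big_cons /= -addn1 natrD mulrDl mul1r addrC lerD //.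
    by apply: IH => // x xu; apply: su; rewrite mem_cat xu.
  by apply/ltW/h1 => // x xu; apply: su; rewrite mem_cat xu orbT.
(* The tolerance per section makes [size t] errors add up to at most [e / 2]; the successor covers
   an empty [t]. *)
have d0 : 0 < e / 2 / ((size t).+1)%:R by rewrite divr_gt0.
have [u0 hu0] := unif _ d0.
pose u := undup (map fst s0 ++ u0).
have uu : uniq u := undup_uniq _.
have h2 := hu0 u uu (@subset_undup_catr _ _ _).
have : `|\sum_(p <- [seq (i, j) | i <- u, j <- t]) a p - S| < e / 2.
  apply: hs0 => [|[i j] ij]; first by apply: allpairs_uniq => // [[? ?] [? ?]] _ _ [-> ->].
  apply: allpairs_f; last by apply: st; apply/mapP; exists (i, j).
  by apply: subset_undup_catl; apply/mapP; exists (i, j).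
rewrite big_allpairs exchange_big /= => h1.
have h3 : `|\sum_(j <- t) (\sum_(i <- u) a (i, j) - b j)| <= e / 2.
  apply: le_trans (ler_norm_sum _ _ _) (le_trans h2 _).
  rewrite mulrC mulrAC ler_pdivrMr ?ltr0n // ler_wpM2l ?ler_nat //; lra.
move: h1 h3; rewrite sumrB; set x := \sum_(_ <- _) _; set y := \sum_(_ <- _) b _ => h1 h3.
have -> : y - S = (x - S) - (x - y) by ring.
by rewrite (le_lt_trans (ler_normB _ _)) //; lra.
Qed.

Lemma sum_pairs_le I J (a : I * J -> R) s : (forall p, 0 <= a p) -> uniq s ->
  \sum_(p <- s) a p <=
    \sum_(i <- undup (map fst s)) \sum_(j <- undup (map snd s)) a (i, j).
Proof.
move=> a0 us; set u := undup _; set t := undup _.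
rewrite -big_allpairs; set r := [seq _ | _ <- _, _ <- _].
have ur : uniq r.
  by apply: allpairs_uniq; rewrite ?undup_uniq // => [[? ?] [? ?]] _ _ [-> ->].
have sr : {subset s <= r}.
  by move=> [i j] ij; apply: allpairs_f; rewrite mem_undup; apply/mapP; exists (i, j).
exact: sum_subset_le.
Qed.

Lemma has_sum_ge I (a : I -> R) S s : (forall x, 0 <= a x) -> has_sum a S ->
  uniq s -> \sum_(x <- s) a x <= S.
Proof.
move=> a0 hS us; rewrite leNgt; apply/negP => lt_S.
have [|s0 hs0] := hS (\sum_(x <- s) a x - S); first by rewrite subr_gt0.
have := hs0 _ (undup_uniq _) (@subset_undup_catr _ s s0); apply/negP; rewrite -leNgt.
apply: le_trans (ler_norm _); rewrite lerD2r.
exact: sum_subset_le (undup_uniq _) (@subset_undup_catl _ _ _).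
Qed.

(** Every finite set of pairs lies in a rectangle, so the iterated sum bounds all partial sums. The
    value follows from [has_sum_fubini], used with swapped coordinates because it sums out the first
    one. *)
Lemma has_sum_tonelli I J (a : I * J -> R) (b : I -> R) S : (forall p, 0 <= a p) ->
  (forall i, has_sum (fun j => a (i, j)) (b i)) -> has_sum b S -> has_sum a S.
Proof.
move=> a0 hb hS.
have [T hT] : summable a.
  apply: (has_sum_nonneg_bounded (B := S)) => // s us.
  apply: le_trans (sum_pairs_le a0 us) _.
  have b0 i : 0 <= b i.
    by have := has_sum_ge (fun j => a0 (i, j)) (hb i) (isT : uniq [::]); rewrite big_nil.
  apply: le_trans (has_sum_ge b0 hS (undup_uniq _)); apply: ler_sum => i _.
  exact: has_sum_ge (fun j => a0 (i, j)) (hb i) (undup_uniq _).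
have hT' : has_sum (fun q : J * I => a (q.2, q.1)) T.
  move=> e e0; have [s0 hs0] := hT e e0.
  exists [seq (p.2, p.1) | p <- s0] => s us ss.
  have swapK (q : J * I) : ((q.2, q.1).2, (q.2, q.1).1) = q by case: q.
  have -> : \sum_(x <- s) a (x.2, x.1) = \sum_(p <- [seq (p.2, p.1) | p <- s]) a p.
    by rewrite big_map.
  apply: hs0 => [|[i j] ij].
    by rewrite map_inj_uniq // => -[? ?] [? ?] [-> ->].
  apply/mapP; exists (j, i) => //; apply: ss; apply/mapP.
  by exists (i, j).
by have := has_sum_fubini hT' hb => h; rewrite (has_sum_unique hS h).
Qed.

(** Absolute bounds on the two factors make the products absolutely summable; Fubini then identifies
    the total. *)
Lemma has_sum_prod I J (a : I -> R) (b : J -> R) S T :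
  has_sum a S -> has_sum b T -> has_sum (fun p : I * J => a p.1 * b p.2) (S * T).
Proof.
move=> ha hb.
have [A hA] := has_sum_abs_bounded ha; have [B hB] := has_sum_abs_bounded hb.
have [C hC] : summable (fun p : I * J => a p.1 * b p.2).
  apply: (summable_abs_bounded (B := A * B)) => s us.
  apply: le_trans (sum_pairs_le (fun p => normr_ge0 (a p.1 * b p.2)) us) _.
  set u := undup _; set t := undup _.
  rewrite (eq_bigr (fun i => `|a i| * (\sum_(j <- t) `|b j|))) => [|i _]; last first.
    by rewrite mulr_sumr; apply: eq_bigr => j _; rewrite normrM.
  by rewrite -mulr_suml ler_pM ?sumr_ge0 ?hA ?hB ?undup_uniq.
have h : has_sum (fun j => S * b j) C.
  apply: has_sum_fubini hC _ => j /=; rewrite mulrC.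
  by apply: eq_has_sum (has_sumZ (b j) ha) => i; rewrite mulrC.
by rewrite -(has_sum_unique h (has_sumZ S hb)).
Qed.

Lemma has_sum_reindex I J (f : J -> I) (a : I -> R) S : injective f ->
  (forall i, (exists j, f j = i) \/ a i = 0) ->
  has_sum (fun j => a (f j)) S -> has_sum a S.
Proof.
move=> fI fa hS e e0; have [s0 hs0] := hS e e0.
exists (map f s0) => s us ss.
(* [t] is the preimage of [s] under [f]; the elements of [s] it misses lie outside the range of [f]
   and contribute 0. *)
have [t [ut memt <-]] : exists t, [/\ uniq t, forall j, (j \in t) = (f j \in s) &
    \sum_(j <- t) a (f j) = \sum_(i <- s) a i].
  elim: s us {ss} => [|i s IH] /=; first by exists [::]; rewrite !big_nil.
  move=> /andP[nis us]; have [t [ut memt st]] := IH us.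
  have [[j ij]|ni] := classic (exists j, f j = i).
    exists (j :: t); split=> [/=|k|]; last by rewrite !big_cons ij st.
      by rewrite memt ij nis.
    by rewrite !inE memt -ij (inj_eq fI).
  exists t; split=> [//|j|]; last first.
    by rewrite big_cons; case: (fa i) => [//|->]; rewrite add0r.
  by rewrite inE memt; case: eqP => // ji; case: ni; exists j.
apply: hs0 => // j js; rewrite memt; apply: ss; exact: map_f.
Qed.

End UnorderedSums.

(** * Finitely supported families *)

Section FiniteFamilies.
Variable V : choiceType.
Local Notation T := {fsfun V -> nat with 0%N}.
Implicit Types (N : T) (x y : V).

Definition empty_family : T := [fsfun for fun _ : V => 0%N].
(** Families are read as finite multisets: [inc] adds a copy of [x], and [dec] removes one, doing
    nothing when [x] is absent. *)
Definition inc N x : T := [fsfun N with x |-> (N x).+1].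
Definition dec N x : T := [fsfun N with x |-> (N x).-1].

Lemma empty_familyE x : empty_family x = 0%N.
Proof. by rewrite fsfunE. Qed.

Lemma incE N x y : inc N x y = (N y + (y == x))%N.
Proof. by rewrite fsfun_withE; case: eqP => [->|_]; rewrite ?addn1 ?addn0. Qed.

Lemma decE N x y : dec N x y = (N y - (y == x))%N.
Proof. by rewrite fsfun_withE; case: eqP => [->|_]; rewrite ?subn1 ?subn0. Qed.

Lemma incK N x : dec (inc N x) x = N.
Proof. by apply/fsfunP => y; rewrite decE incE addnK. Qed.

Lemma decK N x : x \in finsupp N -> inc (dec N x) x = N.
Proof.
rewrite mem_finsupp => Nx; apply/fsfunP => y; rewrite incE decE.
by case: eqP => [->|_] /=; rewrite ?subn0 ?addn0 // subnK // lt0n.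
Qed.

Lemma family_inc_inj x : injective (inc^~ x).
Proof. by move=> N1 N2 e; rewrite -(incK N1 x) e incK. Qed.

Lemma inc_in N x : x \in finsupp (inc N x).
Proof. by rewrite mem_finsupp incE eqxx addn1. Qed.

Lemma dec_inc N x y : y != x -> dec (inc N x) y = inc (dec N y) x.
Proof.
move=> yx; apply/fsfunP => z; rewrite decE !incE decE.
by case: (eqVneq z y) => [->|_]; rewrite ?(negPf yx) ?subn0 ?addn0.
Qed.

(** Used to bring products over the supports of [N] and [inc N x] to one common index set. *)
Lemma big_finsupp (S : Type) (idx : S) (op : Monoid.com_law idx) N (r : seq V) (F : V -> S) :
  uniq r -> {subset finsupp N <= r} -> (forall x, N x = 0%N -> F x = idx) ->
  \big[op/idx]_(x <- finsupp N) F x = \big[op/idx]_(x <- r) F x.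
Proof.
move=> ur sr F0; rewrite [RHS](bigID (mem (finsupp N))) /= [X in op _ X]big1.
  rewrite Monoid.mulm1 -[RHS]big_filter; apply/perm_big/uniq_perm => // [|x].
    by rewrite filter_uniq.
  by rewrite mem_filter andb_idr //; apply: sr.
by move=> x; rewrite mem_finsupp negbK => /eqP /F0.
Qed.

Lemma finsupp_inc_sub N x : {subset finsupp (inc N x) <= x |` finsupp N}%fset.
Proof.
by move=> y; rewrite !inE !mem_finsupp incE; case: (eqVneq y x); rewrite ?addn0.
Qed.

Lemma finsupp_sub_cons N x : {subset finsupp N <= x |` finsupp N}%fset.
Proof. by move=> y yN; rewrite !inE yN orbT. Qed.

Definition msize N : nat := (\sum_(x <- finsupp N) N x)%N.

Lemma msize_inc N x : msize (inc N x) = (msize N).+1.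
Proof.
rewrite /msize (big_finsupp _ (fset_uniq _) (@finsupp_inc_sub N x)) //.
rewrite (big_finsupp _ (fset_uniq _) (@finsupp_sub_cons N x)) //.
rewrite (eq_bigr _ (fun y _ => incE N x y)) big_split /= -addn1; congr addn.
rewrite (big_fsetD1 x (fset1U1 _ _)) /= eqxx big_seq big1 // => y.
by rewrite !inE => /andP[/negPf ->].
Qed.

Lemma msize_eq0 N : (msize N == 0%N) = (N == empty_family).
Proof.
apply/eqP/eqP => [N0|->]; last by rewrite /msize finsupp0 big_seq_fset0.
apply/fsfunP => x; rewrite empty_familyE; apply/eqP/negPn/negP.
rewrite -mem_finsupp => xN; move: N0.
by rewrite -(decK xN) msize_inc.
Qed.

Lemma finsupp_neq0 N : N != empty_family -> exists x, x \in finsupp N.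
Proof.
move=> N0; apply/fset0Pn; apply: contra N0 => /eqP fN.
by rewrite -msize_eq0 /msize fN big_seq_fset0.
Qed.

Lemma family_ind (P : T -> Prop) :
  P empty_family -> (forall N x, P N -> P (inc N x)) -> forall N, P N.
Proof.
move=> P0 PS N; have [n] := ubnP (msize N); elim: n N => // n IH N.
have [->//|/finsupp_neq0[x xN]] := eqVneq N empty_family.
by rewrite -(decK xN) msize_inc ltnS => lt_n; apply/PS/IH.
Qed.

(** Sum over the elements of the multiset [N] counted with multiplicity; [h] receives the chosen
    element and what remains. *)
Definition msum N (h : V -> T -> R) : R :=
  \sum_(x <- finsupp N) (N x)%:R * h x (dec N x).

Lemma msum0 h : msum empty_family h = 0.
Proof. by rewrite /msum finsupp0 big_seq_fset0. Qed.

Lemma eq_msum N h1 h2 :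
  (forall x, x \in finsupp N -> h1 x (dec N x) = h2 x (dec N x)) ->
  msum N h1 = msum N h2.
Proof. by move=> e; apply: eq_big_seq => x xN; rewrite e. Qed.

Lemma msumD N h1 h2 : msum N (fun x b => h1 x b + h2 x b) = msum N h1 + msum N h2.
Proof. by rewrite -big_split; apply: eq_bigr => x _; rewrite /= mulrDr. Qed.

Lemma msumZ N c h : msum N (fun x b => c * h x b) = c * msum N h.
Proof. by rewrite mulr_sumr; apply: eq_bigr => x _; rewrite mulrCA. Qed.

Lemma msum_pick N x h : msum N (fun y b => (y == x)%:R * h y b) = (N x)%:R * h x (dec N x).
Proof.
have [xN|/[dup] xN] := boolP (x \in finsupp N).
  rewrite /msum (big_fsetD1 x) //= eqxx mul1r big_seq big1 ?addr0 // => y.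
  by rewrite !inE => /andP[/negPf -> _]; rewrite mul0r mulr0.
rewrite mem_finsupp negbK => /eqP ->; rewrite mul0r /msum big_seq big1 // => y yN.
by case: eqP => [yx|_]; [rewrite -yx yN in xN | rewrite mul0r mulr0].
Qed.

(** Leibniz rule: the element removed is either the new copy of [x] or an old element. *)
Lemma msum_inc N x h :
  msum (inc N x) h = h x N + msum N (fun y N' => h y (inc N' x)).
Proof.
rewrite /msum (big_finsupp _ (fset_uniq _) (@finsupp_inc_sub N x)) /=; last first.
  by move=> y ->; rewrite mul0r.
rewrite (big_finsupp _ (fset_uniq _) (@finsupp_sub_cons N x)) /=; last first.
  by move=> y ->; rewrite mul0r.
rewrite !(big_fsetD1 x (fset1U1 _ _)) /= !incE eqxx incK addrA; congr (_ + _).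
  have [xN|] := boolP (x \in finsupp N); first by rewrite decK // addn1 -natr1; ring.
  by rewrite mem_finsupp negbK => /eqP ->; rewrite mul0r mul1r addr0.
apply: eq_big_seq => y; rewrite !inE => /andP[yx _].
by rewrite incE (negPf yx) addn0 dec_inc.
Qed.

(** Both sides sum over ordered pairs of elements of [N], which may be drawn in either order. *)
Lemma msum_exchange N (h : V -> V -> T -> R) :
  msum N (fun x b => msum b (h x)) = msum N (fun x b => msum b (h^~ x)).
Proof.
elim/family_ind: N h => [|N x IH] h; first by rewrite !msum0.
have E (g : V -> V -> T -> R) : msum N (fun y b => msum (inc b x) (g y)) =
    msum N (fun y b => g y x b) + msum N (fun y b => msum b (fun z b' => g y z (inc b' x))).
  by rewrite -msumD; apply: eq_msum => y _; rewrite msum_inc.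
rewrite !msum_inc (E h) (E (fun y z => h z y)).
by rewrite (IH (fun y z b => h y z (inc b x))) addrCA.
Qed.

Definition fprod (g : V -> nat -> R) N : R := \prod_(x <- finsupp N) g x (N x).

Lemma fprod0 g : fprod g empty_family = 1.
Proof. by rewrite /fprod finsupp0 big_seq_fset0. Qed.

(** [c] collects the factors away from [x], which the two products share; this form avoids dividing
    by [g x (N x)], which may vanish. *)
Lemma fprod_inc_split g N x : (forall y, g y 0%N = 1) ->
  exists c, fprod g (inc N x) = g x (N x).+1 * c /\ fprod g N = g x (N x) * c.
Proof.
move=> g0; exists (\prod_(y <- ((x |` finsupp N) `\ x)%fset) g y (N y)).
rewrite /fprod (big_finsupp _ (fset_uniq _) (@finsupp_inc_sub N x)) /=; last first.
  by move=> y ->.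
rewrite (big_finsupp _ (fset_uniq _) (@finsupp_sub_cons N x)) /=; last by move=> y ->.
rewrite !(big_fsetD1 x (fset1U1 _ _)) /= incE eqxx addn1; split=> //; congr (_ * _).
by apply: eq_big_seq => y; rewrite !inE incE => /andP[/negPf -> _]; rewrite addn0.
Qed.

Definition poisson_weight (mu : V -> R) := fprod (fun x k => mu x ^+ k / k`!%:R).

Lemma poisson_weight0 mu : poisson_weight mu empty_family = 1.
Proof. exact: fprod0. Qed.

Lemma fact_neq0 k : k`!%:R != 0 :> R.
Proof. by rewrite pnatr_eq0 -lt0n fact_gt0. Qed.

Lemma poisson_weight_inc mu N x :
  poisson_weight mu (inc N x) * (N x).+1%:R = mu x * poisson_weight mu N.
Proof.
rewrite /poisson_weight; have [|c [-> ->]] := @fprod_inc_split (fun x k => mu x ^+ k / k`!%:R) N x.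
  by move=> y; rewrite expr0 divr1.
rewrite factS natrM exprS; field.
by rewrite fact_neq0 nat1r pnatr_eq0.
Qed.

Lemma poisson_weight_ge0 mu N : (forall x, 0 <= mu x) -> 0 <= poisson_weight mu N.
Proof. by move=> mu0; apply: prodr_ge0 => x _; rewrite divr_ge0 ?exprn_ge0. Qed.

Lemma poisson_weight_gt0 mu N : (forall x, 0 < mu x) -> 0 < poisson_weight mu N.
Proof.
by move=> mu0; apply: prodr_gt0 => x _; rewrite divr_gt0 ?exprn_gt0 // ltr0n fact_gt0.
Qed.

Definition family_fact N : nat := (\prod_(x <- finsupp N) (N x)`!)%N.

Lemma family_fact_gt0 N : (0 < family_fact N)%N.
Proof. by rewrite prodn_gt0 // => x; rewrite fact_gt0. Qed.

Lemma family_fact0 : family_fact empty_family = 1%N.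
Proof. by rewrite /family_fact finsupp0 big_seq_fset0. Qed.

Lemma family_fact_inc N x : family_fact (inc N x) = ((N x).+1 * family_fact N)%N.
Proof.
rewrite /family_fact (big_finsupp _ (fset_uniq _) (@finsupp_inc_sub N x)) /=; last first.
  by move=> y ->.
rewrite (big_finsupp _ (fset_uniq _) (@finsupp_sub_cons N x)) /=; last by move=> y ->.
rewrite !(big_fsetD1 x (fset1U1 _ _)) /= incE eqxx addn1 factS -mulnA; congr (_ * (_ * _))%N.
by apply: eq_big_seq => y; rewrite !inE incE => /andP[/negPf -> _]; rewrite addn0.
Qed.

Definition family_seq N : seq V := flatten [seq nseq (N x) x | x <- finsupp N].

Lemma count_family_seq N y : count_mem y (family_seq N) = N y.
Proof.
rewrite count_flatten -map_comp sumnE big_map.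
rewrite (eq_bigr (fun x => (x == y) * N x)%N) => [|x _]; last by rewrite /= count_nseq.
have [yN|yN] := boolP (y \in finsupp N).
  rewrite (big_fsetD1 y) //= eqxx mul1n big_seq big1 ?addn0 // => x.
  by rewrite !inE => /andP[/negPf ->].
rewrite (fsfun_dflt yN) big_seq big1 // => x xN.
by case: eqP => // xy; rewrite -xy xN in yN.
Qed.

Lemma family_seq_inc N x : perm_eq (family_seq (inc N x)) (x :: family_seq N).
Proof. by apply/allP => y _ /=; rewrite !count_family_seq incE addnC (eq_sym x). Qed.

Lemma family_seq0 : family_seq empty_family = [::].
Proof.
rewrite /family_seq finsupp0; apply: size0nil.
by rewrite size_flatten /shape -map_comp sumnE big_map big_seq_fset0.
Qed.

(** The map sending [(x, M)] to [(x, inc M x)] is a bijection onto the pairs [(x, N)] with [x] in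
    the support of [N]; Fubini groups these pairs by [N]. *)
Lemma has_sum_dec (y : V -> T -> R) S : has_sum (fun p : V * T => y p.1 p.2) S ->
  has_sum (fun N => \sum_(x <- finsupp N) y x (dec N x)) S.
Proof.
move=> hS; pose a (p : V * T) := if p.1 \in finsupp p.2 then y p.1 (dec p.2 p.1) else 0.
apply: (@has_sum_fubini _ _ a); last first.
  move=> N; rewrite (eq_big_seq (fun x => a (x, N))) => [|x xN]; last by rewrite /a xN.
  by apply: has_sum_fin => // x xN; rewrite /a (negPf xN).
apply: (@has_sum_reindex _ _ (fun p => (p.1, inc p.2 p.1))).
- by move=> [x N] [x' N'] [-> /family_inc_inj ->].
- move=> [x N]; rewrite /a /=; case: ifP => [xN|_]; last by right.
  by left; exists (x, dec N x); rewrite /= decK.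
- by apply: eq_has_sum hS => -[x N]; rewrite /a /= inc_in incK.
Qed.

End FiniteFamilies.

(** * The exponential series as an unordered sum *)

Lemma has_sum_exp (x : R) : 0 <= x -> has_sum (fun k : nat => x ^+ k / k`!%:R) (exp x).
Proof.
move=> x0; have t0 k : 0 <= x ^+ k / k`!%:R by rewrite divr_ge0 ?exprn_ge0.
have hx : infinite_sum (fun k => Rmult (Rinv (INR (Factorial.fact k))) (pow x k)) (exp x).
  by rewrite /exp; case: (exist_exp x).
have sE n : sum_f_R0 (fun k => Rmult (Rinv (INR (Factorial.fact k))) (pow x k)) n = \sum_(k < n.+1) x ^+ k / k`!%:R.
  rewrite sum_f_R0E big_mkord; apply: eq_bigr => k _.
  by rewrite RinvE INRE RpowE factE RmultE mulrC.
have cvg e : 0 < e -> exists n0, forall n, (n0 <= n)%N ->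
    `|\sum_(k < n) x ^+ k / k`!%:R - exp x| < e.
  move=> e0; have /RltP e0' := e0; have [n0 hn0] := hx e e0'.
  exists n0.+1 => -[//|n] le_n; have /hn0 : ge n n0 by apply/ssrnat.leP.
  by rewrite /Rdist sE RabsE => /RltP.
(* A finite set of naturals lies in an initial segment, so its sum is bounded by an ordinary partial
   sum. *)
have sub (s : seq nat) : uniq s -> \sum_(k <- s) x ^+ k / k`!%:R <=
    \sum_(k < (\max_(k <- s) k).+1) x ^+ k / k`!%:R.
  move=> us; rewrite -(big_mkord xpredT (fun k => x ^+ k / k`!%:R)).
  apply: sum_subset_le => //; first exact: iota_uniq.
  by move=> k ks; rewrite mem_index_iota ltnS; apply: leq_bigmax_seq.
have mono m n : (m <= n)%N ->
    \sum_(k < m) x ^+ k / k`!%:R <= \sum_(k < n) x ^+ k / k`!%:R.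
  move=> mn; rewrite (big_ord_widen n (fun k => x ^+ k / k`!%:R) mn).
  by rewrite [leRHS](bigID (fun k : 'I_n => (k < m)%N)) /= lerDl sumr_ge0.
have ub n : \sum_(k < n) x ^+ k / k`!%:R <= exp x.
  rewrite leNgt; apply/negP => lt_n.
  have [|n0 hn0] := cvg (\sum_(k < n) x ^+ k / k`!%:R - exp x); first by rewrite subr_gt0.
  have := hn0 _ (leq_maxl n0 n); apply/negP; rewrite -leNgt.
  by apply: le_trans (ler_norm _); rewrite lerD2r mono ?leq_maxr.
move=> e e0; have [n0 hn0] := cvg e e0; exists (iota 0 n0) => s us ss.
have h1 : \sum_(k < n0) x ^+ k / k`!%:R <= \sum_(k <- s) x ^+ k / k`!%:R.
  rewrite -(big_mkord xpredT (fun k => x ^+ k / k`!%:R)) /index_iota subn0.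
  by apply: sum_subset_le => //; exact: iota_uniq.
have h2 := le_trans (sub s us) (ub _).
have := hn0 n0 (leqnn _); rewrite !ltr_norml => /andP[h3 h4].
by apply/andP; split; lra.
Qed.

(** * Charlier functions and their kernel *)

Section ChaosBasis.
Variable V : choiceType.
Local Notation T := {fsfun V -> nat with 0%N}.
Implicit Types (N b : T) (x g : V).

Lemma dec_succ N x : x \in finsupp N -> (dec N x x).+1 = N x.
Proof. by rewrite mem_finsupp decE eqxx subn1 -lt0n => /prednK. Qed.

Lemma msize_dec N x : x \in finsupp N -> (msize (dec N x)).+1 = msize N.
Proof. by move=> xN; rewrite -[in RHS](decK xN) msize_inc. Qed.

Lemma poisson_weight_dec mu N x : x \in finsupp N ->
  mu x * poisson_weight mu (dec N x) = (N x)%:R * poisson_weight mu N.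
Proof.
by move=> xN; rewrite -poisson_weight_inc decK // dec_succ // mulrC.
Qed.

(* The mass S_n of the families of size n satisfies n S_n = m S_(n-1). *)
Lemma has_sum_poisson_weight (mu : V -> R) m : (forall x, 0 <= mu x) ->
  has_sum mu m -> has_sum (poisson_weight mu) (exp m).
Proof.
move=> mu0 hm; pose W := poisson_weight mu.
have W0 N : 0 <= W N by exact: poisson_weight_ge0.
have m0 : 0 <= m by have := has_sum_ge mu0 hm (isT : uniq [::]); rewrite big_nil.
(* The size becomes an extra index, so that Tonelli can first sum over the families of each fixed
   size; for a given [N] only [n = msize N] contributes. *)
pose a (p : nat * T) := (msize p.2 == p.1)%:R * W p.2.
have graded n : has_sum (fun N => a (n, N)) (m ^+ n / n`!%:R).
  elim: n => [|n IH].
    have := @has_sum_fin _ (fun N => a (0%N, N)) [:: empty_family V] isT.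
    rewrite big_seq1 /a /= msize_eq0 eqxx /W poisson_weight0 mul1r expr0 divr1; apply=> N.
    by rewrite inE -msize_eq0 => /negPf ->; rewrite mul0r.
  have := has_sum_dec (y := fun x N => mu x * a (n, N)) (has_sum_prod hm IH).
  move/(has_sumZ (n.+1%:R^-1)); set S := _ * (m * _).
  have -> : S = m ^+ n.+1 / (n.+1)`!%:R.
    rewrite /S exprS factS natrM; field; rewrite fact_neq0 /= nat1r pnatr_eq0 //.
  apply: eq_has_sum => N; rewrite (eq_big_seq (fun x => (N x)%:R * a (n.+1, N))).
    rewrite -mulr_suml -natr_sum -/(msize N) /a /=.
    case: eqP => [->|_]; last by rewrite mul0r !mulr0.
    by rewrite mul1r mulrA mulVf ?mul1r // pnatr_eq0.
  move=> x xN; rewrite /a /= -(msize_dec xN) eqSS.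
  by rewrite mulrCA (poisson_weight_dec _ xN) mulrCA.
have h : has_sum a (exp m).
  by apply: has_sum_tonelli graded (has_sum_exp m0) => -[n N]; rewrite mulr_ge0.
apply: has_sum_fubini h _ => N.
have := @has_sum_fin _ (fun n => a (n, N)) [:: msize N] isT.
rewrite big_seq1 /a /= eqxx mul1r; apply=> n.
by rewrite inE eq_sym => /negPf ->; rewrite mul0r.
Qed.

Variables (r : R) (o : V) (phi : V -> V -> R).

(** On coefficients [f b] of [x^b / b!], this is multiplication of the generating function by
    [1 + r^-1 sum_g x_g phi_g(x)]. In the application [r = sqrt lam], [o] is the trivial tree and
    [phi] is the basis one level below. *)
Definition create x (f : T -> R) b : R :=
  f b + r^-1 * msum b (fun g b' => phi g x * f b').

(** Coefficients of [exp(- r x_o)]: the value is 0 as soon as [b] contains an element other than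
    [o]. *)
Definition vacuum : T -> R := fprod (fun g k => (if g == o then - r else 0) ^+ k).

Definition charlier_seq (l : seq V) : T -> R := foldr create vacuum l.

Definition charlier b N : R := charlier_seq (family_seq N) b.

Lemma eq_create x f1 f2 : f1 =1 f2 -> create x f1 =1 create x f2.
Proof. by move=> e b; rewrite /create e; congr (_ + _ * _); apply: eq_msum => g _; rewrite e. Qed.

(** Multiplication operators commute: the second-order term is a sum over ordered pairs of elements
    of [b], symmetric by [msum_exchange]. Hence [charlier] does not depend on the listing chosen by
    [family_seq]. *)
Lemma createC x y f b : create x (create y f) b = create y (create x f) b.
Proof.
pose A z := msum b (fun g b' => phi g z * f b').
pose B z t := msum b (fun g b' => msum b' (fun h b'' => phi g z * (phi h t * f b''))).
have E z t : create z (create t f) b = f b + r^-1 * (A t + A z) + r^-1 ^+ 2 * B z t.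
  rewrite /create -/(A t) (eq_msum (h2 := fun g b' => phi g z * f b' +
      r^-1 * msum b' (fun h b'' => phi g z * (phi h t * f b'')))) => [|g _].
    by rewrite msumD msumZ -/(A z) -/(B z t); ring.
  by rewrite msumZ; ring.
rewrite !E (addrC (A y)); congr (_ + _ * _); rewrite /B msum_exchange.
by apply: eq_msum => g _; apply: eq_msum => h _; rewrite mulrCA.
Qed.

Lemma charlier_seq_rem x l : x \in l -> charlier_seq l =1 charlier_seq (x :: rem x l).
Proof.
elim: l => // y l IH; rewrite inE eq_sym /=; case: eqVneq => [->|_] //= xl b.
by rewrite createC; apply: eq_create; exact: IH.
Qed.

Lemma charlier_seq_perm l1 l2 : perm_eq l1 l2 -> charlier_seq l1 =1 charlier_seq l2.
Proof.
elim: l1 l2 => [|x l1 IH] l2 p12; first by move: p12; rewrite perm_sym => /perm_nilP ->.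
have xl2 : x \in l2 by rewrite -(perm_mem p12) mem_head.
move=> b; rewrite (charlier_seq_rem xl2); apply: eq_create; apply: IH.
by rewrite -(perm_cons x) (perm_trans p12) // perm_to_rem.
Qed.

Lemma charlier_inc b N x : charlier b (inc N x) =
  charlier b N + r^-1 * msum b (fun g b' => phi g x * charlier b' N).
Proof. exact: charlier_seq_perm (family_seq_inc N x) b. Qed.

Lemma vacuum_inc b g : vacuum (inc b g) = - r * (g == o)%:R * vacuum b.
Proof.
rewrite /vacuum; have [//|c [-> ->]] := @fprod_inc_split V (fun h k => (if h == o then - r else 0) ^+ k) b g.
by rewrite exprS; case: eqP => _; rewrite ?mulr0 ?mulr1 ?mul0r // mulrA.
Qed.

Lemma charlier_empty b : charlier b (empty_family V) = vacuum b.
Proof. by rewrite /charlier family_seq0. Qed.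

Lemma charlier0 N : charlier (empty_family V) N = 1.
Proof.
elim/family_ind: N => [|N x IH]; first by rewrite charlier_empty /vacuum fprod0.
by rewrite charlier_inc msum0 mulr0 addr0.
Qed.

(** This is the derivative of the generating function in [x_g]: the exponential yields [- r] when
    [g = o], and the product rule removes one element [x] of [N] with factor [r^-1 phi_g(x)]. *)
Lemma charlier_annihilate b g N : charlier (inc b g) N =
  - r * (g == o)%:R * charlier b N + r^-1 * msum N (fun x N' => phi g x * charlier b N').
Proof.
elim/family_ind: N b => [|N x IH] b.
  by rewrite !charlier_empty vacuum_inc msum0 mulr0 addr0.
rewrite !charlier_inc !msum_inc IH.
rewrite (eq_msum (N := b) (h2 := fun h b' => - r * (g == o)%:R * (phi h x * charlier b' N) +
    r^-1 * msum N (fun y N' => phi h x * (phi g y * charlier b' N')))); last first.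
  by move=> h _; rewrite IH msumZ; ring.
rewrite [in RHS](eq_msum (N := N) (h2 := fun y N' => phi g y * charlier b N' +
    r^-1 * msum b (fun h b' => phi g y * (phi h x * charlier b' N')))); last first.
  by move=> y _; rewrite charlier_inc msumZ; ring.
rewrite !msumD !msumZ.
(* Both double sums choose one element of [N] and, independently, one of [b]. *)
set A := msum N (fun y N' => msum b _); set B := msum b (fun h b' => msum N _).
suff -> : A = B by ring.
rewrite /A /B /msum; under eq_bigr do rewrite mulr_sumr.
rewrite exchange_big; apply: eq_bigr => h _ /=; rewrite mulr_sumr.
by apply: eq_bigr => y _; ring.
Qed.

Hypothesis r0 : r != 0.
Hypothesis phi_o : forall x, phi o x = 1.

Section Kernel.
Variables (om : V -> R) (s : R) (Lam : V -> V -> R).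
Hypotheses (om0 : forall g, 0 <= om g) (om_o : om o = s).
Hypothesis hLam : forall x y, has_sum (fun g => om g * phi g x * phi g y) (Lam x y).

(** Two instances are used: [om g = s ^+ tree_size g] with [Lam = s L] for the likelihood ratio, and
    [om = 1] with [Lam x y = (x == y) / p x] for completeness. *)
Definition kernel_term N N' b := poisson_weight om b * charlier b N * charlier b N'.

(** The creation rule in [N] removes some [g] from [b]; reindexing by the remaining family leaves
    [charlier (inc b g) N'], to which the annihilation rule applies. The sum over [g] then factors
    out: it gives [- r s] from [g = o] and [Lam x y] from each [y] in [N']. *)
Lemma has_sum_kernel_inc N N' x (q : T -> R) :
  has_sum (kernel_term N N') (q N') ->
  (forall y, y \in finsupp N' -> has_sum (kernel_term N (dec N' y)) (q (dec N' y))) ->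
  has_sum (kernel_term (inc N x) N')
    ((1 - s) * q N' + r ^- 2 * msum N' (fun y b => Lam x y * q b)).
Proof.
move=> hq hq'.
pose Y g b := om g * phi g x * (poisson_weight om b * charlier b N * charlier (inc b g) N').
have hY : has_sum (fun p : V * T => Y p.1 p.2)
    (- r * s * q N' + \sum_(y <- finsupp N') r^-1 * (N' y)%:R * (Lam x y * q (dec N' y))).
  have h1 : has_sum (fun g => om g * phi g x * (- r * (g == o)%:R)) (- r * s).
    have := @has_sum_fin _ (fun g => om g * phi g x * (- r * (g == o)%:R)) [:: o] isT.
    rewrite big_seq1 eqxx om_o phi_o !mulr1 mulrC; apply=> g.
    by rewrite inE => /negPf ->; rewrite !mulr0.
  have h2 y : y \in finsupp N' -> has_sum (fun p : V * T => r^-1 * (N' y)%:R *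
      (om p.1 * phi p.1 x * phi p.1 y * kernel_term N (dec N' y) p.2))
      (r^-1 * (N' y)%:R * (Lam x y * q (dec N' y))).
    by move=> yN'; exact: has_sumZ (has_sum_prod (hLam x y) (hq' y yN')).
  apply: eq_has_sum (has_sumD (has_sum_prod h1 hq) (has_sum_sum h2)) => -[g b] /=.
  rewrite /Y charlier_annihilate /kernel_term /msum !mulrDr; congr (_ + _); first by ring.
  by rewrite !mulr_sumr; apply: eq_bigr => y _; ring.
have := has_sumD hq (has_sumZ r^-1 (has_sum_dec hY)).
have -> : q N' + r^-1 * (- r * s * q N' +
    \sum_(y <- finsupp N') r^-1 * (N' y)%:R * (Lam x y * q (dec N' y))) =
    (1 - s) * q N' + r ^- 2 * msum N' (fun y b => Lam x y * q b).
  rewrite (eq_bigr (fun y => r^-1 * ((N' y)%:R * (Lam x y * q (dec N' y))))) => [|y _].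
    by rewrite -mulr_sumr -/(msum N' (fun y b => Lam x y * q b)); field.
  by rewrite -mulrA.
apply: eq_has_sum => b; rewrite /kernel_term charlier_inc /msum mulrDr mulrDl; congr (_ + _).
rewrite [poisson_weight om b * _]mulrCA -[RHS]mulrA; congr (_ * _).
rewrite mulr_sumr mulr_suml; apply: eq_big_seq => g gb.
rewrite /Y (decK gb) -mulrA; have := poisson_weight_dec om gb => e.
transitivity (phi g x * charlier (dec b g) N * charlier b N' *
  (om g * poisson_weight om (dec b g))); first by ring.
by rewrite e; ring.
Qed.

(** The hypotheses on [Q] determine it on all pairs, and the kernel sums obey the same rules. When
    [N] is empty, the symmetry of the kernel turns [N'] into the argument on which the recursion
    runs. *)
Lemma has_sum_kernel (Q : T -> T -> R) : 0 <= s ->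
  Q (empty_family V) (empty_family V) = exp (s * r ^+ 2) ->
  (forall N x, Q (empty_family V) (inc N x) = (1 - s) * Q (empty_family V) N) ->
  (forall N N' x, Q (inc N x) N' =
    (1 - s) * Q N N' + r ^- 2 * msum N' (fun y b => Lam x y * Q N b)) ->
  forall N N', has_sum (kernel_term N N') (Q N N').
Proof.
move=> s0 Q00 Q0i Qi.
have sym N M S : has_sum (kernel_term N M) S -> has_sum (kernel_term M N) S.
  by apply: eq_has_sum => b; rewrite /kernel_term mulrAC.
elim/family_ind => [|N x IH] N'; last first.
  by rewrite Qi; apply: has_sum_kernel_inc.
apply: (sym); elim/family_ind: N' => [|N' x IH].
  (* At two empty families the terms are squares of [vacuum], that is, Poisson weights of an
     intensity carried by [o] alone, of mass [s * r ^+ 2]. *)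
  rewrite Q00; apply: eq_has_sum (has_sum_poisson_weight
      (mu := fun g => om g * ((g == o)%:R * r ^+ 2)) _ _) => [b|g|].
  - rewrite /kernel_term !charlier_empty /poisson_weight /vacuum /fprod -!big_split /=.
    apply: eq_bigr => g _; rewrite exprMn; case: eqP => _.
      by rewrite mul1r -sqrrN expr2 [(_ * _) ^+ _]exprMn; move: (_ ^+ _) (_ ^+ _) => u v; ring.
    by case: (b g) => [|k]; rewrite ?expr0 ?mulr1 // mul0r !expr0n !(mulr0, mul0r).
  - by apply: mulr_ge0 => //; apply: mulr_ge0; rewrite ?ler0n ?sqr_ge0.
  - have := @has_sum_fin _ (fun g => om g * ((g == o)%:R * r ^+ 2)) [:: o] isT.
    rewrite big_seq1 eqxx om_o mul1r; apply=> g.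
    by rewrite inE => /negPf ->; rewrite mul0r mulr0.
have := @has_sum_kernel_inc N' (empty_family V) x (fun=> Q (empty_family V) N') IH.
by rewrite msum0 mulr0 addr0 Q0i; apply=> y; rewrite finsupp0.
Qed.
End Kernel.
End ChaosBasis.

(** * Moments under the law of a Poisson family *)

Section IndexedFamilies.
Variables (V : choiceType) (n : nat).
Local Notation T := {fsfun V -> nat with 0%N}.
Implicit Types (B : 'I_n -> T) (i j : 'I_n) (b c : T) (g : V).

Definition upd B i b : 'I_n -> T := fun j => if j == i then b else B j.

Definition total B : nat := (\sum_i msize (B i))%N.

Lemma upd_id B i : upd B i (B i) = B.
Proof. by apply: functional_extensionality => j; rewrite /upd; case: eqP => [->|]. Qed.

Lemma upd_upd B i b c : upd (upd B i b) i c = upd B i c.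
Proof. by apply: functional_extensionality => j; rewrite /upd; case: eqP. Qed.

Lemma upd_same B i b : upd B i b i = b.
Proof. by rewrite /upd eqxx. Qed.

Lemma total_upd B i b : (total (upd B i b) + msize (B i) = total B + msize b)%N.
Proof.
rewrite /total (bigD1 i) //= [X in (_ = X + _)%N](bigD1 i) //= upd_same.
rewrite (eq_bigr (fun j => msize (B j))) => [|j /negPf ji]; last by rewrite /upd ji.
lia.
Qed.

Lemma prod_upd (F : T -> 'I_n -> R) B i b :
  \prod_j F (upd B i b j) j = F b i * \prod_(j | j != i) F (B j) j.
Proof.
rewrite (bigD1 i) //= upd_same; congr (_ * _).
by apply: eq_bigr => j /negPf ji; rewrite /upd ji.
Qed.

Lemma total_eq0 B : total B = 0%N -> B = fun=> empty_family V.
Proof.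
move=> B0; apply: functional_extensionality => i; apply/eqP.
by rewrite -msize_eq0 -leqn0 -B0 /total (bigD1 i) //= leq_addr.
Qed.

Lemma total_neq0 B : total B <> 0%N ->
  exists C i g, B = upd C i (inc (C i) g) /\ (total C < total B)%N.
Proof.
move=> B0; have [i Bi] : exists i, B i != empty_family V.
  apply: NNPP => nB; apply: B0; rewrite /total big1 // => i _; apply/eqP; rewrite msize_eq0.
  by apply/negPn/negP => Bi; apply: nB; exists i.
have [g gB] := finsupp_neq0 Bi; exists (upd B i (dec (B i) g)), i, g.
rewrite upd_same upd_upd decK // upd_id; split=> //.
by have := total_upd B i (dec (B i) g); have := msize_dec gB; lia.
Qed.

Lemma total_upd_dec B i g : (total (upd B i (dec (B i) g)) <= total B)%N.
Proof.
have := total_upd B i (dec (B i) g).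
have [/msize_dec|gB] := boolP (g \in finsupp (B i)); first by lia.
suff -> : dec (B i) g = B i by lia.
apply/fsfunP => x; rewrite decE; case: eqP => [->|_]; last by rewrite subn0.
by rewrite (fsfun_dflt gB).
Qed.

End IndexedFamilies.

Section PoissonFamilies.
Variable V : choiceType.
Local Notation T := {fsfun V -> nat with 0%N}.
Implicit Types (N b : T) (x g : V).

Variables (r : R) (p : V -> R).
Hypotheses (r0 : r != 0) (p0 : forall x, 0 <= p x) (p1 : has_sum p 1).

(** Law of a Poisson family of intensity [r ^+ 2 * p]; the single exponential factor reflects that
    [p] has mass 1. *)
Definition poisson_law N : R := exp (- r ^+ 2) * poisson_weight (fun x => r ^+ 2 * p x) N.

Lemma poisson_law_inc N x :
  poisson_law (inc N x) * (N x).+1%:R = r ^+ 2 * p x * poisson_law N.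
Proof. by rewrite /poisson_law -mulrA poisson_weight_inc mulrCA. Qed.

Lemma poisson_law_dec N x : x \in finsupp N ->
  r ^+ 2 * p x * poisson_law (dec N x) = (N x)%:R * poisson_law N.
Proof. by move=> xN; rewrite -poisson_law_inc decK // dec_succ // mulrC. Qed.

Lemma has_sum_poisson_law : has_sum poisson_law 1.
Proof.
have h : has_sum (fun x => r ^+ 2 * p x) (r ^+ 2).
  by rewrite -[X in has_sum _ X]mulr1; apply: has_sumZ.
have := has_sumZ (exp (- r ^+ 2)) (has_sum_poisson_weight (fun x => mulr_ge0 (sqr_ge0 r) (p0 x)) h).
have -> // : exp (- r ^+ 2) * exp (r ^+ 2) = 1.
by have := exp_plus (- r ^+ 2) (r ^+ 2); rewrite RplusE addNr exp_0 RmultE => <-.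
Qed.

(** Mecke formula: removing an element [x] from a Poisson family leaves an independent Poisson
    family, by [poisson_law_dec] and the bijection behind [has_sum_dec]. *)
Lemma has_sum_mecke (h : V -> T -> R) S :
  has_sum (fun q : V * T => p q.1 * poisson_law q.2 * h q.1 q.2) S ->
  has_sum (fun N => poisson_law N * msum N h) (r ^+ 2 * S).
Proof.
move=> hS.
have := has_sum_dec (y := fun x N => r ^+ 2 * (p x * poisson_law N * h x N)) (has_sumZ (r ^+ 2) hS).
apply: eq_has_sum => N; rewrite /msum mulr_sumr; apply: eq_big_seq => x xN.
transitivity (r ^+ 2 * p x * poisson_law (dec N x) * h x (dec N x)); first by ring.
by rewrite (poisson_law_dec xN); ring.
Qed.

Variables (o : V) (phi : V -> V -> R).
Hypothesis phi_o : forall x, phi o x = 1.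
Local Notation e := (charlier r o phi).

Section Completeness.
Hypothesis p_gt0 : forall x, 0 < p x.
Hypothesis phi_complete : forall x y,
  has_sum (fun g => phi g x * phi g y) ((x == y)%:R / p x).

Lemma poisson_law_gt0 N : 0 < poisson_law N.
Proof.
apply: mulr_gt0; first by apply/RltP/exp_pos.
by apply: poisson_weight_gt0 => x; rewrite mulr_gt0 // exprn_even_gt0.
Qed.

(** Instance [s = 1] of the kernel recursion: the unmatched term disappears, and the inverse of the
    law on the diagonal satisfies what is left. *)
Lemma charlier_complete N N' :
  has_sum (kernel_term r o phi (fun=> 1) N N') ((N == N')%:R / poisson_law N).
Proof.
have law0 M : poisson_law M != 0 by rewrite lt0r_neq0 ?poisson_law_gt0.
apply: (@has_sum_kernel V r o phi r0 phi_o (fun=> 1) 1 (fun x y => (x == y)%:R / p x) _ _ _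
  (fun N N' => (N == N')%:R / poisson_law N)) => //.
- by move=> x y; apply: eq_has_sum (phi_complete x y) => g; rewrite mul1r.
- rewrite eqxx mul1r /poisson_law poisson_weight0 mulr1 mul1r.
  have := exp_plus (- r ^+ 2) (r ^+ 2); rewrite RplusE addNr exp_0 RmultE => E.
  by apply: (mulfI (x := exp (- r ^+ 2))); rewrite -?E ?divff //;
    rewrite lt0r_neq0 //; apply/RltP/exp_pos.
- move=> M x; rewrite subrr mul0r; case: eqP => [E|]; last by rewrite mul0r.
  by have := incE M x x; rewrite -E empty_familyE eqxx addn1.
move=> M M' x; rewrite subrr mul0r add0r.
(* Completeness of [phi] retains only the removal of [x] itself from [M']. *)
rewrite (eq_msum (h2 := fun y b => (y == x)%:R * ((M == b)%:R / (p x * poisson_law M)))); last first.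
  by move=> y _; rewrite (eq_sym y) (invfM (p x)); ring.
rewrite msum_pick; have [xM|xM] := boolP (x \in finsupp M'); last first.
  case: eqP => [E|_]; first by rewrite -E inc_in in xM.
  by move: xM; rewrite mem_finsupp negbK => /eqP ->; rewrite !mul0r mulr0.
rewrite -{1}(decK xM) (inj_eq (@family_inc_inj _ x)); case: eqP => [E|_]; last first.
  by rewrite !mul0r !mulr0.
rewrite -(dec_succ xM) -E; have E' := poisson_law_inc M x.
have -> : poisson_law (inc M x) = r ^+ 2 * p x * poisson_law M / (M x).+1%:R.
  by rewrite -E' mulfK // pnatr_eq0.
field; rewrite r0 law0 lt0r_neq0 //= nat1r pnatr_eq0 //.
Qed.
End Completeness.

Section Moments.
Hypothesis phi_summable : forall G : seq V, summable (fun x => p x * \prod_(g <- G) phi g x).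
Variable n : nat.
Implicit Types (B : 'I_n -> T) (G : seq V) (i j : 'I_n).

Definition base_moment G : R := tsum (fun x => p x * \prod_(g <- G) phi g x).

Definition moment_term B N : R := poisson_law N * \prod_i e (B i) N.

Definition moment B : R := tsum (moment_term B).

(* Sum over [(x, N)] of [p x * poisson_law N] times the [phi g x] for [g \in G] and
   the [e (B i)], taken at [inc N x] for [i \in l] and at [N] for the other [i]. *)
Fixpoint shifted_moment (l : seq 'I_n) G B : R :=
  match l with
  | [::] => base_moment G * moment B
  | i :: l' => shifted_moment l' G B +
      r^-1 * msum (B i) (fun g b => shifted_moment l' (g :: G) (upd B i b))
  end.

(** Each index of [l] is expanded by the creation rule, which moves a factor [phi g x] into [G] and
    shrinks [B i]. Once [l] is exhausted, [x] and [N] are independent and the sum factorizes. *)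
Lemma has_sum_shifted_moment (l : seq 'I_n) G B : uniq l ->
  (forall B', (total B' <= total B)%N -> summable (moment_term B')) ->
  has_sum (fun q : V * T => p q.1 * poisson_law q.2 * ((\prod_(g <- G) phi g q.1) *
      \prod_i e (B i) (if i \in l then inc q.2 q.1 else q.2)))
    (shifted_moment l G B).
Proof.
elim: l G B => [|i l IH] G B /=.
  move=> _ /(_ B (leqnn _)) /tsumP hB.
  apply: eq_has_sum (has_sum_prod (tsumP (phi_summable G)) hB) => -[x N] /=.
  by rewrite /moment_term; ring.
move=> /andP[nil ul] hB.
have h2 g : g \in finsupp (B i) -> has_sum (fun q : V * T => r^-1 * (B i g)%:R *
    (p q.1 * poisson_law q.2 * ((\prod_(h <- g :: G) phi h q.1) *
    \prod_j e (upd B i (dec (B i) g) j) (if j \in l then inc q.2 q.1 else q.2))))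
    (r^-1 * (B i g)%:R * shifted_moment l (g :: G) (upd B i (dec (B i) g))).
  move=> gB; apply/has_sumZ/IH => // B' le_B'; apply: hB; apply: leq_trans le_B' _.
  by have := total_upd B i (dec (B i) g); have := msize_dec gB; lia.
have := has_sumD (IH G B ul hB) (has_sum_sum h2).
rewrite (eq_bigr (fun g => r^-1 * ((B i g)%:R * shifted_moment l (g :: G) (upd B i (dec (B i) g)))))
  => [|g _]; last by rewrite -mulrA.
rewrite -mulr_sumr; apply: eq_has_sum => -[x N] /=.
set c := p x * poisson_law N; set P := \prod_(g <- G) phi g x.
pose Z := \prod_(j | j != i) e (B j) (if j \in l then inc N x else N).
rewrite [X in c * (P * X) + _](bigD1 i) //= (negPf nil) -/Z.
rewrite [in RHS](bigD1 i) //= mem_head charlier_inc.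
rewrite [X in _ = c * (P * (_ * X))](_ : _ = Z); last first.
  by apply: eq_bigr => j /negPf ji; rewrite inE ji.
rewrite [in RHS]mulrDl !mulrDr; congr (_ + _).
rewrite /msum mulr_sumr mulr_suml !mulr_sumr; apply: eq_bigr => g _.
rewrite big_cons (prod_upd (fun b j => e b (if j \in l then inc N x else N))) (negPf nil).
by rewrite -/Z -/P; ring.
Qed.

(** The annihilation rule applied to factor [i] produces the subtracted term and a sum over the
    elements of [N]. Mecke's formula turns the latter into a sum over [(x, N)] where factor [i] sees
    [N] and all the others see [inc N x]. *)
Lemma has_sum_moment_inc B i g :
  (forall B', (total B' <= total B)%N -> summable (moment_term B')) ->
  has_sum (moment_term (upd B i (inc (B i) g)))
    (r * (shifted_moment [seq j <- enum 'I_n | j != i] [:: g] B - (g == o)%:R * moment B)).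
Proof.
move=> hB; set l := [seq _ <- _ | _].
have lE j : (j \in l) = (j != i) by rewrite mem_filter mem_enum andbT.
have ul : uniq l by rewrite filter_uniq ?enum_uniq.
have h1 := has_sum_shifted_moment [:: g] ul hB.
have := has_sum_mecke (h := fun x N => (\prod_(g <- [:: g]) phi g x) *
      \prod_i e (B i) (if i \in l then inc N x else N)) h1.
move/(has_sumZ r^-1)/(has_sumD (has_sumZ (- r * (g == o)%:R) (tsumP (hB B (leqnn _))))).
rewrite -/(moment B); set S := _ + _.
have -> : S = r * (shifted_moment l [:: g] B - (g == o)%:R * moment B) by rewrite /S; field.
apply: eq_has_sum => N; rewrite /moment_term (prod_upd (fun b _ => e b N)).
rewrite [X in _ * (_ * X)](bigD1 i) //= charlier_annihilate.
set Z := \prod_(j | j != i) e (B j) N.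
rewrite (eq_msum (h2 := fun x N' => Z * (phi g x * e (B i) N'))).
  by rewrite msumZ; ring.
move=> x xN; rewrite big_seq1 (bigD1 i) //= lE eqxx /=.
rewrite [X in _ * (_ * X) = _](_ : _ = Z); first by ring.
by apply: eq_bigr => j ji; rewrite lE ji (decK xN).
Qed.

Lemma has_sum_moment_empty : has_sum (moment_term (fun=> empty_family V)) 1.
Proof.
apply: eq_has_sum has_sum_poisson_law => N; rewrite /moment_term big1 ?mulr1 // => i _.
exact: charlier0.
Qed.

(** Summability is obtained along with the value, by induction on the total size of [B]. *)
Lemma summable_moment B : summable (moment_term B).
Proof.
have [k] := ubnP (total B); elim: k B => // k IH B.
have [/total_eq0 ->|/eqP/total_neq0[C [i [g [-> lt_C]]]]] := eqVneq (total B) 0%N.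
  by exists 1; exact: has_sum_moment_empty.
move=> le_k; eexists; apply: has_sum_moment_inc => B' le_B'; apply: IH.
by move: (leq_trans lt_C le_k) le_B' => /[swap]; exact: leq_ltn_trans.
Qed.

Lemma moment_empty : moment (fun=> empty_family V) = 1.
Proof. exact: tsumE has_sum_moment_empty. Qed.

Lemma moment_inc B i g : moment (upd B i (inc (B i) g)) =
  r * (shifted_moment [seq j <- enum 'I_n | j != i] [:: g] B - (g == o)%:R * moment B).
Proof. by apply/tsumE/has_sum_moment_inc => B' _; exact: summable_moment. Qed.

End Moments.

Section Orthogonality.
Hypothesis phi_summable : forall G : seq V, summable (fun x => p x * \prod_(g <- G) phi g x).
Hypothesis phi_mean : forall g, base_moment [:: g] = (g == o)%:R.
Hypothesis phi_orth : forall h g, base_moment [:: h; g] = (h == g)%:R.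

Let pair_fun b b' : 'I_2 -> T := fun i => if i == ord0 then b else b'.

(** Removing [g] from [b] forces the removal of a [g] from [b'], with factor the multiplicity of [g]
    in [b']; iterating yields the product of factorials. *)
Lemma charlier_orthogonal b b' :
  has_sum (fun N => poisson_law N * e b N * e b' N) ((b == b')%:R * (family_fact b)%:R).
Proof.
suff <- : moment (pair_fun b b') = (b == b')%:R * (family_fact b)%:R.
  apply: eq_has_sum (tsumP (summable_moment phi_summable (pair_fun b b'))) => N.
  by rewrite /moment_term big_ord_recl big_ord1 /= mulrA.
have rest (i j : 'I_2) : i != j -> [seq k <- enum 'I_2 | k != i] = [:: j].
  move=> ij; apply: perm_small_eq => //; apply: uniq_perm => //.
    by rewrite filter_uniq ?enum_uniq.
  move=> k; rewrite mem_filter mem_enum andbT inE.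
  by case: i j k ij => [[|[|i]] ?] [[|[|j]] ?] [[|[|k]] ?].
have fstE c c' g : pair_fun (inc c g) c' = upd (pair_fun c c') ord0 (inc (pair_fun c c' ord0) g).
  by apply: functional_extensionality => j; rewrite /upd /pair_fun; case: eqP.
have sndE c c' g : pair_fun c (inc c' g) =
    upd (pair_fun c c') ord_max (inc (pair_fun c c' ord_max) g).
  apply: functional_extensionality => j; rewrite /upd /pair_fun.
  by case: j => [[|[|j]] ?].
have upd_snd c c' d : upd (pair_fun c c') ord_max d = pair_fun c d.
  by apply: functional_extensionality => -[[|[|j]] ?].
elim/family_ind: b b' => [|b g IH] b'.
  rewrite family_fact0 mulr1; elim/family_ind: b' => [|b' g _].
    rewrite eqxx; transitivity (moment (fun _ : 'I_2 => empty_family V)).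
      congr moment.
      by apply: functional_extensionality => j; rewrite /pair_fun; case: eqP.
    exact: moment_empty.
  rewrite sndE moment_inc // (rest _ ord0) //= msum0 phi_mean mulr0 addr0 subrr mulr0.
  by case: eqP => // E; have := incE b' g g; rewrite -E empty_familyE eqxx addn1.
(* The mean of [phi g] cancels the subtracted term, leaving only pairings of [g] with an element of
   [b']. *)
rewrite fstE moment_inc // (rest _ ord_max) //= phi_mean addrAC subrr add0r.
rewrite (eq_msum (h2 := fun h c => (h == g)%:R * moment (pair_fun b c))); last first.
  by move=> h _; rewrite phi_orth upd_snd.
rewrite msum_pick mulrA divff // mul1r IH.
have [gb|gb] := boolP (g \in finsupp b'); last first.
  move: (gb); rewrite mem_finsupp negbK => /eqP ->; rewrite mul0r.
  by case: eqP => [E|_]; [rewrite -E inc_in in gb | rewrite mul0r].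
rewrite -[in RHS](decK gb) (inj_eq (@family_inc_inj _ g)) -(dec_succ gb).
by case: eqP => [<-|_]; rewrite ?mul0r ?mulr0 // !mul1r family_fact_inc natrM.
Qed.

End Orthogonality.
End PoissonFamilies.

(** * The correlated model *)

Section Pushforward.
Variables (U V : choiceType) (f : U -> V).
Local Notation TU := {fsfun U -> nat with 0%N}.
Local Notation TV := {fsfun V -> nat with 0%N}.

(** Image of the multiset [M] under [f]; for [fst] and [snd] these are the row and column sums of a
    matching. *)
Definition push (M : TU) : TV :=
  [fsfun x in (f @` finsupp M)%fset => (\sum_(q <- finsupp M) (f q == x) * M q)%N | 0%N].

Lemma pushE M x : push M x = (\sum_(q <- finsupp M) (f q == x) * M q)%N.
Proof.
rewrite fsfunE; case: ifP => // nx; rewrite big_seq big1 // => q qM.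
by case: eqP => // fq; move: nx; rewrite -fq in_imfset.
Qed.

Lemma push_inc M q : push (inc M q) = inc (push M) (f q).
Proof.
apply/fsfunP => x; rewrite incE !pushE.
rewrite (big_finsupp _ (fset_uniq _) (@finsupp_inc_sub U M q)) => [|y ->]; last by rewrite muln0.
rewrite (big_finsupp _ (fset_uniq _) (@finsupp_sub_cons U M q)) => [|y ->]; last by rewrite muln0.
rewrite !(big_fsetD1 q (fset1U1 _ _)) /= incE eqxx mulnDr muln1 (eq_sym x) -!addnA.
congr (_ + _)%N; rewrite addnC; congr (_ + _)%N.
by apply: eq_big_seq => y; rewrite !inE incE => /andP[/negPf ->]; rewrite addn0.
Qed.

Lemma push0 : push (empty_family U) = empty_family V.
Proof. by apply/fsfunP => x; rewrite pushE finsupp0 big_seq_fset0 empty_familyE. Qed.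

Lemma leq_push (M : TU) q : (M q <= push M (f q))%N.
Proof.
have [qM|/fsfun_dflt -> //] := boolP (q \in finsupp M).
by rewrite pushE (big_fsetD1 q) //= eqxx mul1n leq_addr.
Qed.
End Pushforward.

Section Coupling.
Variable V : choiceType.
Local Notation T := {fsfun V -> nat with 0%N}.
Local Notation T2 := {fsfun (V * V)%type -> nat with 0%N}.
Implicit Types (N C : T) (x : V) (M : T2).

(** Weight of the [n - k] unmatched copies. The explicit 0 for [n < k] is essential: truncated
    subtraction would give weight 1. *)
Definition poisson_rest (m : R) (n k : nat) : R :=
  if (k <= n)%N then m ^+ (n - k) / (n - k)`!%:R else 0.

Lemma poisson_restSS m n k : poisson_rest m n.+1 k.+1 = poisson_rest m n k.
Proof. by rewrite /poisson_rest ltnS subSS. Qed.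

Lemma poisson_rest00 m : poisson_rest m 0 0 = 1.
Proof. by rewrite /poisson_rest /= expr0 divr1. Qed.

Lemma poisson_restS m n k : poisson_rest m n.+1 k * n.+1%:R =
  m * poisson_rest m n k + k%:R * poisson_rest m n.+1 k.
Proof.
rewrite /poisson_rest; have [le_kn|lt_nk] := leqP k n.
  rewrite (leqW le_kn) subSn // factS exprS natrM.
  have -> : n.+1%:R = (n - k).+1%:R + k%:R :> R by rewrite -natrD addSn subnK.
  field; rewrite fact_neq0 /= nat1r pnatr_eq0 //.
rewrite mulr0 add0r; case: (leqP k n.+1) => [le_k|_]; last by rewrite mul0r mulr0.
have -> : k = n.+1 by apply/eqP; rewrite eqn_leq le_k.
by rewrite mulrC.
Qed.

Definition rest_weight (mu : V -> R) N C : R :=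
  \prod_(x <- (finsupp N `|` finsupp C)%fset) poisson_rest (mu x) (N x) (C x).

Lemma rest_weightE mu N C (r : seq V) : uniq r ->
  {subset finsupp N <= r} -> {subset finsupp C <= r} ->
  rest_weight mu N C = \prod_(x <- r) poisson_rest (mu x) (N x) (C x).
Proof.
move=> ur Nr Cr; rewrite [RHS](bigID (mem (finsupp N `|` finsupp C)%fset)) /=.
rewrite [X in _ = _ * X]big1 ?mulr1 => [|x]; last first.
  rewrite inE negb_or !mem_finsupp !negbK => /andP[/eqP -> /eqP ->].
  exact: poisson_rest00.
rewrite -[RHS]big_filter; apply/perm_big/uniq_perm => // [|x].
  by rewrite filter_uniq.
by rewrite mem_filter andb_idr // inE => /orP[/Nr|/Cr].
Qed.

Lemma rest_weight_split mu N C x : exists c, forall N' C',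
  (forall y, y != x -> N' y = N y) -> (forall y, y != x -> C' y = C y) ->
  rest_weight mu N' C' = poisson_rest (mu x) (N' x) (C' x) * c.
Proof.
pose A := (x |` (finsupp N `|` finsupp C))%fset.
exists (\prod_(y <- (A `\ x)%fset) poisson_rest (mu y) (N y) (C y)) => N' C' eN eC.
rewrite (@rest_weightE _ _ _ A) => [||y|y]; first last.
- by rewrite !inE !mem_finsupp; case: (eqVneq y x) => //= /eC ->; rewrite orbC => ->.
- by rewrite !inE !mem_finsupp; case: (eqVneq y x) => //= /eN -> ->.
- exact: fset_uniq.
rewrite (big_fsetD1 x (fset1U1 _ _)) /=; congr (_ * _).
by apply: eq_big_seq => y; rewrite !inE => /andP[yx _]; rewrite eN // eC.
Qed.

Lemma inc_neq N x y : y != x -> inc N x y = N y.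
Proof. by move=> /negPf yx; rewrite incE yx addn0. Qed.

Lemma rest_weight_incl mu N C x : rest_weight mu (inc N x) C * (N x).+1%:R =
  mu x * rest_weight mu N C + (C x)%:R * rest_weight mu (inc N x) C.
Proof.
have [c h] := rest_weight_split mu N C x.
rewrite (h (inc N x) C) // => [|y /inc_neq -> //]; rewrite (h N C) //.
by rewrite incE eqxx addn1 mulrAC poisson_restS; ring.
Qed.

Lemma rest_weight_inc2 mu N C x : rest_weight mu (inc N x) (inc C x) = rest_weight mu N C.
Proof.
have [c h] := rest_weight_split mu N C x.
rewrite h => [|y /inc_neq -> //|y /inc_neq -> //]; rewrite h //.
by rewrite !incE eqxx !addn1 poisson_restSS.
Qed.

Lemma rest_weight_gt mu N C x : (N x < C x)%N -> rest_weight mu N C = 0.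
Proof.
move=> lt_x; have [c ->//] := rest_weight_split mu N C x.
by rewrite /poisson_rest leqNgt lt_x mul0r.
Qed.

Lemma rest_weight0 mu N : rest_weight mu N (empty_family V) = poisson_weight mu N.
Proof.
rewrite (@rest_weightE _ _ _ (finsupp N)) // => [|x]; last by rewrite finsupp0.
by apply: eq_bigr => x _; rewrite empty_familyE /poisson_rest subn0.
Qed.

Variables (mu : V -> R) (nu : V * V -> R).

(* Up to an exponential factor, the probability that [M] counts the matched pairs and
   that [(N, N')] is observed.  Letting [M] range over all finitely supported families
   makes the index set independent of [(N, N')], unlike in [Pcor]. *)
Definition coupling_weight N N' M : R :=
  poisson_weight nu M * rest_weight mu N (push fst M) * rest_weight mu N' (push snd M).

Lemma has_sum_coupling_empty N' :
  has_sum (coupling_weight (empty_family V) N') (poisson_weight mu N').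
Proof.
have := @has_sum_fin _ (coupling_weight (empty_family V) N') [:: empty_family _] isT.
have -> : \sum_(M <- [:: empty_family _]) coupling_weight (empty_family V) N' M =
    poisson_weight mu N'.
  by rewrite big_seq1 /coupling_weight !push0 !rest_weight0 !poisson_weight0 !mul1r.
apply=> M; rewrite inE => /finsupp_neq0[q qM]; rewrite /coupling_weight.
rewrite (@rest_weight_gt _ _ _ q.1) ?mulr0 ?mul0r // empty_familyE.
by apply: leq_trans (leq_push fst M q); rewrite lt0n -mem_finsupp.
Qed.

(** Each of the [(N x).+1] copies of [x] is either unmatched, giving [mu x], or matched with some
    [y] of [N'], giving [nu (x, y)] once the matched pair is removed. *)
Lemma coupling_sum_inc (S : T -> T -> R) N N' x :
  (forall N N', has_sum (coupling_weight N N') (S N N')) ->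
  S (inc N x) N' * (N x).+1%:R =
    mu x * S N N' + \sum_(y <- finsupp N') nu (x, y) * S N (dec N' y).
Proof.
move=> hS.
(* The indicator demands [q.2] in the support of [N']: otherwise [dec] would change nothing and
   spurious terms would appear. *)
pose Y (q : V * V) M : R := ((q.1 == x) && (q.2 \in finsupp N'))%:R * nu q *
  coupling_weight N (dec N' q.2) M.
have hY : has_sum (fun p : (V * V) * T2 => Y p.1 p.2)
    (\sum_(y <- finsupp N') nu (x, y) * S N (dec N' y)).
  have h y : y \in finsupp N' -> has_sum (fun p : (V * V) * T2 =>
      (p.1 == (x, y))%:R * nu p.1 * coupling_weight N (dec N' y) p.2)
      (nu (x, y) * S N (dec N' y)).
    move=> yN; apply: (@has_sum_prod _ _ (fun q => (q == (x, y))%:R * nu q)) (hS _ _).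
    have := @has_sum_fin _ (fun q => (q == (x, y))%:R * nu q) [:: (x, y)] isT.
    rewrite big_seq1 eqxx mul1r; apply=> q.
    by rewrite inE => /negPf ->; rewrite mul0r.
  apply: eq_has_sum (has_sum_sum h) => -[[u v] M]; rewrite /Y /=.
  have [vN|vN] := boolP (v \in finsupp N').
    rewrite (big_fsetD1 v) //= big_seq big1 ?addr0 => [|y]; last first.
      by rewrite !inE xpair_eqE eq_sym => /andP[/negPf -> _]; rewrite andbF !mul0r.
    by rewrite xpair_eqE eqxx andbT.
  rewrite andbF !mul0r big_seq big1 // => y yN; rewrite xpair_eqE.
  by case: (eqVneq v y) => [vy|]; [rewrite vy yN in vN | rewrite andbF !mul0r].
have := has_sumD (has_sumZ (mu x) (hS N N')) (has_sum_dec hY).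
apply: has_sum_unique; rewrite mulrC.
apply: eq_has_sum (has_sumZ (N x).+1%:R (hS (inc N x) N')) => M.
have -> : \sum_(q <- finsupp M) Y q (dec M q) =
    (push fst M x)%:R * coupling_weight (inc N x) N' M.
  rewrite pushE natr_sum mulr_suml; apply: eq_big_seq => q qM.
  rewrite /Y natrM /coupling_weight; case: eqP => [qx|_]; last by rewrite !mul0r.
  rewrite -[in RHS](decK qM) !push_inc qx /= rest_weight_inc2 (decK qM).
  have e := poisson_weight_dec nu qM; rewrite !mul1r.
  have [qN|qN] := boolP (q.2 \in finsupp N').
    rewrite -[in RHS](decK qN) rest_weight_inc2.
    by rewrite !mulrA mul1r e; ring.
  rewrite (@rest_weight_gt _ N' _ q.2) ?mulr0 ?mul0r //.
  by move: qN; rewrite mem_finsupp negbK => /eqP ->; rewrite incE eqxx addn1.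
rewrite /coupling_weight; set W := poisson_weight _ _; set Z := rest_weight _ N' _.
transitivity (W * Z * (rest_weight mu (inc N x) (push fst M) * (N x).+1%:R)); first by ring.
by rewrite rest_weight_incl; ring.
Qed.

End Coupling.

(** * Reduction of couplings to finite matrices *)

Section CouplingFinite.
Variables (V : choiceType) (mu : V -> R) (nu : V * V -> R).
Local Notation T := {fsfun V -> nat with 0%N}.
Local Notation T2 := {fsfun (V * V)%type -> nat with 0%N}.
Variables t t' : T.
Local Notation A := (finsupp t).
Local Notation B := (finsupp t').
Local Notation K := (\sum_(a <- finsupp t) t a)%N.
Local Notation matrices := {ffun A * B -> 'I_K.+1}.
Implicit Types (M : matrices) (q : V * V).

Let row M (a : A) : nat := (\sum_(b : B) M (a, b))%N.
Let col M (b : B) : nat := (\sum_(a : A) M (a, b))%N.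

Definition matrix_entry M q : nat :=
  if (insub q.1 : option A, insub q.2 : option B) is (Some a, Some b) then M (a, b) : nat
  else 0%N.

Definition family_of_matrix M : T2 := [fsfun q in (A `*` B)%fset => matrix_entry M q | 0%N].

Lemma family_of_matrixE M q : family_of_matrix M q = matrix_entry M q.
Proof.
rewrite fsfunE; case: ifP => //; rewrite in_fsetM /matrix_entry.
by case: insubP => [a -> _|//]; case: insubP => // b ->.
Qed.

Lemma family_of_matrix_val M (a : A) (b : B) : family_of_matrix M (val a, val b) = M (a, b).
Proof. by rewrite family_of_matrixE /matrix_entry /= !valK. Qed.

Lemma family_of_matrix_supp M q : q \in finsupp (family_of_matrix M) ->
  (q.1 \in A) && (q.2 \in B).
Proof.
rewrite (mem_finsupp (family_of_matrix M)) family_of_matrixE /matrix_entry.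
by case: insubP => [a -> _|//]; case: insubP => [b -> //|//].
Qed.

Lemma big_family_of_matrix (S : Type) (idx : S) (op : Monoid.com_law idx) M (F : V * V -> S) :
  (forall q, family_of_matrix M q = 0%N -> F q = idx) ->
  \big[op/idx]_(q <- finsupp (family_of_matrix M)) F q =
  \big[op/idx]_(a : A) \big[op/idx]_(b : B) F (val a, val b).
Proof.
move=> F0; rewrite (big_finsupp _ (r := [seq (a, b) | a <- A, b <- B]) _ _ F0).
- rewrite big_allpairs big_seq_fsetE; apply: eq_bigr => a _.
  by rewrite big_seq_fsetE.
- by apply: allpairs_uniq => // -[? ?] [? ?] _ _ [-> ->].
- by move=> [x y] /family_of_matrix_supp /andP[/= xA yB]; apply: allpairs_f.
Qed.

Lemma push_fst_matrix M (a : A) : push fst (family_of_matrix M) (val a) = row M a.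
Proof.
rewrite pushE big_family_of_matrix => [|q ->]; last by rewrite muln0.
rewrite (bigD1 a) //= [X in (_ + X)%N]big1 ?addn0 => [|c ca]; last first.
  by rewrite big1 // => b _; rewrite (inj_eq val_inj) (negPf ca).
by apply: eq_bigr => b _; rewrite eqxx mul1n family_of_matrix_val.
Qed.

Lemma push_snd_matrix M (b : B) : push snd (family_of_matrix M) (val b) = col M b.
Proof.
rewrite pushE big_family_of_matrix => [|q ->]; last by rewrite muln0.
rewrite exchange_big (bigD1 b) //= [X in (_ + X)%N]big1 ?addn0 => [|c cb]; last first.
  by rewrite big1 // => a _; rewrite (inj_eq val_inj) (negPf cb).
by apply: eq_bigr => a _; rewrite eqxx mul1n family_of_matrix_val.
Qed.

Lemma finsupp_push_matrix M :
  {subset finsupp (push fst (family_of_matrix M)) <= A} /\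
  {subset finsupp (push snd (family_of_matrix M)) <= B}.
Proof.
split=> x; rewrite mem_finsupp pushE; apply: contraR => nx;
  rewrite big_seq big1 // => q /family_of_matrix_supp /andP[h1 h2];
  by case: eqP => // e; rewrite -e ?h1 ?h2 in nx.
Qed.

Lemma rest_weight_finsupp (m : V -> R) (N : T) (C : T) (c : finsupp N -> nat) :
  {subset finsupp C <= finsupp N} -> (forall a, C (val a) = c a) ->
  rest_weight m N C = if [forall a, (c a <= N (val a))%N] then
    \prod_(a : finsupp N) (m (val a) ^+ (N (val a) - c a) / (N (val a) - c a)`!%:R) else 0.
Proof.
move=> sC eC; rewrite (@rest_weightE _ _ _ _ (finsupp N)) // big_seq_fsetE.
case: ifP => [/forallP le_c|/negbT/forallPn[a lt_a]].
  by apply: eq_bigr => a _; rewrite eC /poisson_rest le_c.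
by rewrite (bigD1 a) //= eC /poisson_rest (negPf lt_a) mul0r.
Qed.

(** A coupling of nonzero weight has row and column sums bounded by [t] and [t'], so it lives on the
    product of the supports and comes from exactly one matrix. *)
Lemma has_sum_coupling_finite : has_sum (coupling_weight mu nu t t')
  (\sum_(M : matrices | [forall a, (row M a <= t (val a))%N] &&
                        [forall b, (col M b <= t' (val b))%N])
    (\prod_(p : A * B) (nu (val p.1, val p.2) ^+ M p / (M p)`!%:R)) *
    (\prod_(a : A) (mu (val a) ^+ (t (val a) - row M a) / (t (val a) - row M a)`!%:R)) *
    (\prod_(b : B) (mu (val b) ^+ (t' (val b) - col M b) / (t' (val b) - col M b)`!%:R))).
Proof.
rewrite big_mkcond; apply: (@has_sum_reindex _ matrices family_of_matrix).
- move=> M M' e; apply/ffunP => -[a b]; apply/val_inj.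
  by rewrite /= -!family_of_matrix_val e.
- move=> M; case: (eqVneq (coupling_weight mu nu t t' M) 0) => [|W0]; first by right.
  have le1 q : (M q <= t q.1)%N.
    rewrite leqNgt; apply/negP => lt_q; move: W0; rewrite /coupling_weight.
    by rewrite (rest_weight_gt _ (leq_trans lt_q (leq_push fst M q))) mulr0 mul0r eqxx.
  have le2 q : (M q <= t' q.2)%N.
    rewrite leqNgt; apply/negP => lt_q; move: W0; rewrite /coupling_weight.
    by rewrite (rest_weight_gt _ (leq_trans lt_q (leq_push snd M q))) mulr0 eqxx.
  left; exists [ffun p => inord (M (val p.1, val p.2))]; apply/fsfunP => q.
  rewrite family_of_matrixE /matrix_entry; case: insubP => [a qA va|qA]; last first.
    by apply/esym/eqP; rewrite -leqn0 (leq_trans (le1 q)) // fsfun_dflt.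
  case: insubP => [b qB vb|qB]; last first.
    by apply/esym/eqP; rewrite -leqn0 (leq_trans (le2 q)) // fsfun_dflt.
  (* The entry is at most [t q.1], hence at most the total of [t], so [inord] does not alter it. *)
  rewrite ffunE /= va vb -surjective_pairing inordK // ltnS (leq_trans (le1 q)) //.
  by rewrite (big_fsetD1 q.1) //= leq_addr.
apply: eq_has_sum (has_sum_fintype _) => M; rewrite /coupling_weight.
have [s1 s2] := finsupp_push_matrix M.
rewrite (rest_weight_finsupp _ s1 (push_fst_matrix M)).
rewrite (rest_weight_finsupp _ s2 (push_snd_matrix M)).
case: [forall a, (row M a <= _)%N]; last by rewrite mulr0 mul0r.
case: [forall b, (col M b <= _)%N]; last by rewrite mulr0.
congr (_ * _ * _); rewrite /poisson_weight /fprod.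
rewrite big_family_of_matrix => [|q ->]; last by rewrite expr0 divr1.
rewrite pair_big; apply: eq_bigr => -[a b] _ /=.
by rewrite family_of_matrix_val.
Qed.

End CouplingFinite.

(** * Coefficients of the exponential of a pairing sum *)

Section PairingCoefficients.
Variable n : nat.
Implicit Types (m : 'I_n -> nat) (i j : 'I_n) (k : nat).

Definition raise m i : 'I_n -> nat := fun j => (m j + (j == i))%N.
Definition lower m i : 'I_n -> nat := fun j => (m j - (j == i))%N.

Lemma multinom_raise m i : [multinom raise m i j | j < n] = ([multinom m j | j < n] + U_(i))%MM.
Proof. by apply/mnmP => j; rewrite mnmDE !mnmE /raise eq_sym. Qed.

Lemma raise_lower m i : m i != 0%N -> raise (lower m i) i = m.
Proof.
move=> mi; apply: functional_extensionality => j; rewrite /raise /lower.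
by case: eqP => [->|_]; rewrite ?subn0 ?addn0 // subnK // lt0n.
Qed.

Lemma mderiv_Qpoly i : mderiv i (Qpoly n) = \sum_(j | j != i) 'X_j.
Proof.
have dX a : mderiv i ('X_a : {mpoly int[n]}) = (a == i)%:R.
  rewrite mderivX mnm1E; case: eqP => [->|_]; last by rewrite scale0r.
  by rewrite scale1r (_ : (U_(i) - U_(i))%MM = 0%MM) ?mpolyX0 //; apply/mnmP => j; rewrite mnmBE mnm0E subnn.
rewrite /Qpoly raddf_sum /=; under eq_bigr do rewrite raddf_sum /=.
under eq_bigr => a _ do under eq_bigr => b _ do rewrite mderivM !dX.
under eq_bigr do rewrite big_split /=; rewrite big_split /=.
rewrite (bigD1 i) //= [X in _ + X + _]big1 ?addr0 => [|a /negPf ai]; last first.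
  by rewrite big1 // => b _; rewrite ai mul0r.
under eq_bigr do rewrite eqxx mul1r.
rewrite [X in _ + X = _](eq_bigr (fun a : 'I_n => if (a < i)%N then 'X_a else 0)) => [|a _]; last first.
  case: ifP => ai.
    rewrite (bigD1 i) //= eqxx mulr1 big1 ?addr0 // => b /andP[_ /negPf ->].
    by rewrite mulr0.
  by rewrite big1 // => b ab; case: eqP => [bi|_]; [rewrite -bi ab in ai | rewrite mulr0].
rewrite -big_mkcond [RHS](bigID (fun a : 'I_n => (i < a)%N)) /=; congr (_ + _).
  by apply: eq_bigl => a; rewrite andb_idl // => ia; rewrite -val_eqE /= neq_ltn ia orbT.
by apply: eq_bigl => a; rewrite -leqNgt ltn_neqAle.
Qed.

Lemma mcoeff_mulX (q : {mpoly int[n]}) j m : (q * 'X_j)@_[multinom m i | i < n] =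
  if m j == 0%N then 0 else q@_[multinom lower m j i | i < n].
Proof.
case: eqP => [mj|/eqP mj].
  apply/eqP; rewrite mcoeff_eq0 (perm_mem (msuppMX _ _)).
  apply/mapP => -[m' _ /mnmP/(_ j)].
  by rewrite mnmDE mnm1E eqxx mnmE mj.
by rewrite -[in LHS](raise_lower mj) multinom_raise addmC mcoeffMX.
Qed.

(** Compares coefficients in the identity [d/dx_i Q^(k+1) = (k+1) Q^k sum_(j != i) x_j]. *)
Lemma Qcoef_raise k m i : Qcoef k.+1 (raise m i) *+ (m i).+1 =
  (\sum_(j | j != i) if m j == 0%N then 0 else Qcoef k (lower m j)) *+ k.+1.
Proof.
have dE l : mderiv i (Qpoly n ^+ l.+1) = (Qpoly n ^+ l * mderiv i (Qpoly n)) *+ l.+1.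
  elim: l => [|l IH]; first by rewrite expr1 expr0 mul1r.
  by rewrite exprS mderivM IH -mulrnAr exprS mulrSr [RHS]mulrSr; ring.
rewrite /Qcoef multinom_raise -[in (m i).+1](mnmE m i) -mcoeff_deriv dE mcoeffMn; congr (_ *+ _).
rewrite mderiv_Qpoly mulr_sumr raddf_sum /=.
by apply: eq_bigr => j _; rewrite mcoeff_mulX.
Qed.

Lemma Qpoly_homog : Qpoly n \is 2.-homog.
Proof.
rewrite /Qpoly; apply: rpred_sum => a _; apply: rpred_sum => b _.
by rewrite -[2%N]/(1 + 1)%N; apply: dhomogM; rewrite dhomogX /= mdeg1.
Qed.

Lemma Qcoef_degree k m : (\sum_i m i < k)%N -> Qcoef k m = 0.
Proof.
move=> lt_k; apply: (dhomog_nemf_coeff (dhomogMn k Qpoly_homog)).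
rewrite /= mdegE (eq_bigr m) => [|i _]; last by rewrite mnmE.
by rewrite neq_ltn (leq_trans lt_k) ?leq_pmull.
Qed.

(** Longer truncations add only zeros, since [Q^k] is homogeneous of degree [2k]. A free bound [K]
    lets coefficients of different degrees share one truncation. *)
Lemma exp_coefE m K : (\sum_i m i < K)%N ->
  exp_coef m = \sum_(k < K) (Qcoef k m)%:~R / k`!%:R.
Proof.
have intRE z : intR z = z%:~R.
  by case: z => k; rewrite /intR INRE.
move=> le_K; rewrite [RHS](bigID (fun k : 'I_K => (k < (\sum_i m i).+1)%N)) /=.
rewrite [X in _ = _ + X]big1 ?addr0 => [|k]; last first.
  by rewrite -ltnNge => lt_k; rewrite Qcoef_degree // mul0r.
rewrite -(big_ord_widen K (fun k => (Qcoef k m)%:~R / k`!%:R)) //.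
by apply: eq_bigr => k _; rewrite intRE INRE RdivE.
Qed.

Lemma exp_coef0 : exp_coef (fun _ : 'I_n => 0%N) = 1.
Proof.
rewrite (@exp_coefE _ 1); last by rewrite big1.
rewrite big_ord1 /Qcoef expr0 divr1.
have -> : [multinom (fun _ : 'I_n => 0%N) i | i < n] = 0%MM by apply/mnmP => i; rewrite !mnmE.
by rewrite mcoeff1 eqxx.
Qed.

Lemma sum_raise m i : (\sum_j raise m i j = (\sum_j m j).+1)%N.
Proof.
rewrite big_split /= -addn1; congr addn.
by rewrite (bigD1 i) //= eqxx big1 // => j /negPf ->.
Qed.

(** Coefficient form of [d/dx_i exp Q = (sum_(j != i) x_j) exp Q]. *)
Lemma exp_coef_raise m i : exp_coef (raise m i) * (m i).+1%:R =
  \sum_(j | j != i) if m j == 0%N then 0 else exp_coef (lower m j).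
Proof.
have lt_K := ltnSn (\sum_j m j); set K := (X in (_ < X)%N) in lt_K.
rewrite (@exp_coefE _ K.+1) ?sum_raise // mulr_suml big_ord_recl /=.
(* The term [k = 0] vanishes because the monomial is not constant; the others shift by one, with
   [(k+1) / (k+1)! = 1 / k!]. *)
have -> : Qcoef 0 (raise m i) = 0.
  by rewrite /Qcoef expr0 mcoeff1; case: eqP => // /mnmP/(_ i); rewrite mnmE mnm0E /raise eqxx addn1.
rewrite !mul0r add0r (eq_bigr (fun k : 'I_K => \sum_(j | j != i)
    if m j == 0%N then 0 else (Qcoef k (lower m j))%:~R / k`!%:R)) => [|k _]; last first.
  have := congr1 (fun z : int => z%:~R : R) (Qcoef_raise k m i); rewrite !rmorphMn /= => e.
  move: e; rewrite -mulr_natr -[RHS]mulr_natr; set S := (\sum_(_ | _) _) => e.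
  transitivity (S%:~R / k`!%:R : R).
    rewrite /bump /= add1n factS natrM mulrAC e; field.
    by rewrite fact_neq0 /= nat1r pnatr_eq0.
  rewrite /S rmorph_sum mulr_suml; apply: eq_bigr => j _ /=.
  by case: ifP; rewrite ?mul0r.
rewrite exchange_big; apply: eq_bigr => j _ /=; case: eqP => [_|/eqP mj]; first exact: big1.
by rewrite -exp_coefE // ltnW // ltnS -{2}(raise_lower mj) sum_raise.
Qed.

(** Number of perfect matchings of disjoint blocks of sizes [m i] with no pair inside a block;
    equivalently, the Gaussian mean of a product of Hermite polynomials. *)
Definition pairing_moment m : R := (\prod_i (m i)`!)%N%:R * exp_coef m.

Lemma pairing_moment0 : pairing_moment (fun=> 0%N) = 1.
Proof. by rewrite /pairing_moment big1 // exp_coef0 mul1r. Qed.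

Lemma prod_fact_raise m i : (\prod_j (raise m i j)`! = (m i).+1 * \prod_j (m j)`!)%N.
Proof.
rewrite (bigD1 i) //= [in RHS](bigD1 i) //= mulnA -factS /raise eqxx addn1.
by congr (_ * _)%N; apply: eq_bigr => j /negPf ->; rewrite addn0.
Qed.

(** The new element of block [i] is paired with one of the [m j] elements of another block [j]. *)
Lemma pairing_moment_raise m i : pairing_moment (raise m i) =
  \sum_(j | j != i) (m j)%:R * pairing_moment (lower m j).
Proof.
rewrite /pairing_moment prod_fact_raise natrM.
transitivity ((\prod_j (m j)`!)%N%:R * (exp_coef (raise m i) * (m i).+1%:R)); first by ring.
rewrite exp_coef_raise mulr_sumr; apply: eq_bigr => j _.
case: eqP => [->|/eqP mj]; first by rewrite mulr0 mul0r.
rewrite -{1}(raise_lower mj) prod_fact_raise natrM mulrA; congr (_%:R * _ * _).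
by rewrite /lower eqxx subn1 prednK ?lt0n.
Qed.

End PairingCoefficients.

(** * Large intensity limit of the moments *)

Section LimitsAtInfinity.
Implicit Types (u v : R -> R) (l : R).

Definition tends u l : Prop :=
  forall e : R, 0 < e -> exists M : R, forall x : R, M <= x -> `|u x - l| < e.

(** Agreement on positive [x] is what is available, as the facts about the basis hold for
    [lam > 0]. *)
Lemma tends_eq u v l : (forall x, 0 < x -> u x = v x) -> tends u l -> tends v l.
Proof.
move=> uv hu e e0; have [M hM] := hu e e0; exists (Num.max M 1) => x.
rewrite ge_max => /andP[Mx x1]; rewrite -uv ?hM //.
exact: lt_le_trans ltr01 x1.
Qed.

Lemma tends_cst l : tends (fun=> l) l.
Proof. by move=> e e0; exists 0 => x _; rewrite subrr normr0. Qed.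

Lemma tendsD u v l l' : tends u l -> tends v l' -> tends (fun x => u x + v x) (l + l').
Proof.
move=> hu hv e e0; have e2 : 0 < e / 2 by rewrite divr_gt0.
have [M hM] := hu _ e2; have [M' hM'] := hv _ e2; exists (Num.max M M') => x.
rewrite ge_max => /andP[/hM h /hM' h'].
by rewrite opprD addrACA (le_lt_trans (ler_normD _ _)) //; lra.
Qed.

Lemma tendsM u v l l' : tends u l -> tends v l' -> tends (fun x => u x * v x) (l * l').
Proof.
move=> hu hv e e0; set c := 1 + `|l| + `|l'|.
have c1 : 1 <= c by rewrite /c -addrA lerDl addr_ge0.
have c0 : 0 < c by exact: lt_le_trans ltr01 c1.
(* [d <= 1] bounds the quadratic error by [d], so the total error is at most [d * c], which is at
   most [e / 2]. *)
pose d := Num.min 1 (e / (2 * c)).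
have d0 : 0 < d by rewrite lt_min ltr01 divr_gt0 // mulr_gt0.
have [M hM] := hu _ d0; have [M' hM'] := hv _ d0; exists (Num.max M M') => x.
rewrite ge_max => /andP[/hM h /hM' h'].
have -> : u x * v x - l * l' = (u x - l) * (v x - l') + (l * (v x - l') + (u x - l) * l') by ring.
have [d1 de] : d <= 1 /\ d <= e / (2 * c) by rewrite /d !ge_min !lexx orbT.
have b1 : `|(u x - l) * (v x - l')| <= d.
  rewrite normrM -[leRHS]mulr1; apply: ler_pM => //; first exact: ltW.
  by apply: le_trans (ltW h') d1.
have b2 : `|l * (v x - l')| <= `|l| * d by rewrite normrM ler_wpM2l // ltW.
have b3 : `|(u x - l) * l'| <= d * `|l'| by rewrite normrM ler_wpM2r // ltW.
apply: le_lt_trans (ler_normD _ _) _; apply: le_lt_trans (lerD b1 (ler_normD _ _)) _.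
apply: (@le_lt_trans _ _ (d * c)); first by rewrite /c; lra.
by move: de; rewrite ler_pdivlMr ?mulr_gt0 // => de; lra.
Qed.

Lemma tends_sum (I : eqType) (s : seq I) (u : I -> R -> R) (l : I -> R) :
  (forall i, i \in s -> tends (u i) (l i)) ->
  tends (fun x => \sum_(i <- s) u i x) (\sum_(i <- s) l i).
Proof.
elim: s => [|i s IH] h.
  by rewrite big_nil; apply: tends_eq (tends_cst 0) => x _; rewrite big_nil.
rewrite big_cons; apply: tends_eq (tendsD (h i (mem_head _ _)) (IH _)) => [x _|j js].
  by rewrite big_cons.
by apply: h; rewrite inE js orbT.
Qed.

Lemma tends_unique u l l' : tends u l -> tends u l' -> l = l'.
Proof.
move=> hu hu'; apply/eqP/negPn/negP => ll'.
have e0 : 0 < `|l - l'| / 2 by rewrite divr_gt0 // normr_gt0 subr_eq0.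
have [M hM] := hu _ e0; have [M' hM'] := hu' _ e0; pose x := Num.max M M'.
have := hM x; have := hM' x; rewrite !le_max !lexx orbT => /(_ isT) h' /(_ isT) h.
have : `|l - l'| <= `|u x - l'| + `|u x - l|.
  by have -> : l - l' = (u x - l') - (u x - l) by [ring]; exact: ler_normB.
lra.
Qed.

Lemma tends_inv_sqrt : tends (fun x => (sqrt x)^-1) 0.
Proof.
move=> e e0; exists ((e / 2) ^- 2) => x hx; rewrite subr0.
have e2 : 0 < e / 2 by rewrite divr_gt0.
have x0 : 0 < x by apply: lt_le_trans hx; rewrite invr_gt0 exprn_gt0.
have s0 : 0 < sqrt x by apply/RltP/sqrt_lt_R0/RltP.
have xE : x = sqrt x ^+ 2 by rewrite expr2 -[RHS]/(Rmult _ _) sqrt_sqrt //; apply/RleP/ltW.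
rewrite gtr0_norm ?invr_gt0 // (@le_lt_trans _ _ (e / 2)) //; last by lra.
rewrite invf_ple ?posrE // -(@ler_pXn2r _ 2) ?nnegrE ?invr_ge0 ?(ltW e2) ?(ltW s0) //.
by rewrite exprVn -xE.
Qed.

End LimitsAtInfinity.

(** * Survival of the pairings in the limit *)

Section MomentLimit.
Variable V : choiceType.
Local Notation T := {fsfun V -> nat with 0%N}.
Variables (o : V) (p : R -> V -> R) (phi : R -> V -> V -> R) (minf : seq V -> R).

Hypothesis p0 : forall (lam : R) x, 0 < lam -> 0 <= p lam x.
Hypothesis p1 : forall lam : R, 0 < lam -> has_sum (p lam) 1.
Hypothesis phi_o : forall (lam : R) x, 0 < lam -> phi lam o x = 1.
Hypothesis phi_summable : forall (lam : R) (G : seq V), 0 < lam ->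
  summable (fun x => p lam x * \prod_(g <- G) phi lam g x).
Hypothesis phi_orth : forall (lam : R) h g, 0 < lam ->
  base_moment (p lam) (phi lam) [:: h; g] = (h == g)%:R.
Hypothesis minf_lim : forall G, tends (fun lam => base_moment (p lam) (phi lam) G) (minf G).

Variables (n : nat) (S : seq V).
Hypothesis S_uniq : uniq S.
Implicit Types (B C D : 'I_n -> T) (i j : 'I_n) (G : seq V) (g : V).

Let mom lam B := moment (sqrt lam) (p lam) o (phi lam) B.
Let smom lam l G B := shifted_moment (sqrt lam) (p lam) o (phi lam) l G B.

Lemma sqrt_neq0 (lam : R) : 0 < lam -> sqrt lam != 0.
Proof. by move=> lam0; rewrite lt0r_neq0 //; apply/RltP/sqrt_lt_R0/RltP. Qed.

Lemma base_moment_single (lam : R) g : 0 < lam ->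
  base_moment (p lam) (phi lam) [:: g] = (g == o)%:R.
Proof.
move=> lam0; rewrite -(phi_orth g o lam0); congr tsum; apply: functional_extensionality => x.
by rewrite !big_cons big_nil (phi_o _ lam0) mul1r.
Qed.

(** Different coordinates [g] decouple in the limit. The fixed list [S] covers all supports, so the
    index set stays the same throughout the induction. *)
Definition limit_moment B : R := \prod_(g <- S) pairing_moment (fun i => B i g).

Definition covered B := forall i, {subset finsupp (B i) <= S}.

Lemma limit_moment_inc B i g : g \in S -> limit_moment (upd B i (inc (B i) g)) =
  \sum_(j | j != i) (B j g)%:R * limit_moment (upd B j (dec (B j) g)).
Proof.
move=> gS; pose Z := \prod_(h <- S | h != g) pairing_moment (fun j => B j h).
have E j (b : T) : (forall h, h != g -> b h = B j h) -> limit_moment (upd B j b) =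
    pairing_moment (fun k => if k == j then b g else B k g) * Z.
  move=> hb; rewrite /limit_moment (bigD1_seq g) //=; congr (_ * _).
    by congr pairing_moment; apply: functional_extensionality => k; rewrite /upd; case: eqP.
  apply: eq_bigr => h hg; congr pairing_moment; apply: functional_extensionality => k.
  by rewrite /upd; case: eqP => // ->; rewrite hb.
rewrite E => [|h /inc_neq //].
have -> : (fun k => if k == i then inc (B i) g g else B k g) = raise (fun j => B j g) i.
  apply: functional_extensionality => k; rewrite /raise incE eqxx.
  by case: eqP => [->|_]; rewrite ?addn0.
rewrite pairing_moment_raise mulr_suml; apply: eq_bigr => j _.
rewrite E => [|h /negPf hg]; last by rewrite decE hg subn0.
rewrite -mulrA; congr (_ * (pairing_moment _ * _)); apply: functional_extensionality => k.
by rewrite /lower decE eqxx; case: eqP => [->|_]; rewrite ?subn0.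
Qed.

Lemma covered_upd_dec B i g : covered B -> covered (upd B i (dec (B i) g)).
Proof.
move=> cB j x; rewrite /upd; case: eqP => [_|_]; last exact: cB.
by move=> xB; apply: (cB i); move: xB; rewrite !mem_finsupp decE; case: (B i x).
Qed.

(** Each expansion step adds a correction with a factor [1 / sqrt lam] and a convergent cofactor, so
    only the unexpanded term remains. *)
Lemma tends_shifted_moment k l G B :
  (forall C, (total C <= k)%N -> covered C -> tends (mom^~ C) (limit_moment C)) ->
  (total B <= k)%N -> covered B ->
  tends (fun lam => smom lam l G B) (minf G * limit_moment B).
Proof.
move=> IH; elim: l G B => [|i l IHl] G B le_B cB.
  by apply: tendsM => //; exact: IH.
rewrite -[minf G * _]addr0.
rewrite -(mul0r (msum (B i) (fun g b => minf (g :: G) * limit_moment (upd B i b)))).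
apply: tendsD; first exact: IHl.
apply: tendsM tends_inv_sqrt _; apply: tends_sum => g _.
apply: tendsM; first exact: tends_cst.
apply: IHl; last exact: covered_upd_dec.
exact: leq_trans (total_upd_dec B i g) le_B.
Qed.

(* [shifted_moment] is a polynomial in [1 / sqrt lam]: its constant term is subtracted,
   its linear term survives by orthogonality, and the rest vanishes in the limit. *)
Lemma tends_centered_moment k l g B :
  (forall C, (total C <= k)%N -> covered C -> tends (mom^~ C) (limit_moment C)) ->
  (total B <= k)%N -> covered B ->
  tends (fun lam => sqrt lam * (smom lam l [:: g] B - (g == o)%:R * mom lam B))
    (\sum_(j <- l) (B j g)%:R * limit_moment (upd B j (dec (B j) g))).
Proof.
move=> IH le_B cB; elim: l => [|j l IHl].
  rewrite big_nil; apply: tends_eq (tends_cst 0) => lam lam0.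
  by rewrite /smom /= base_moment_single // subrr mulr0.
rewrite big_cons addrC -(msum_pick (B j) g (fun _ b => limit_moment (upd B j b))).
apply: tends_eq (tendsD IHl (_ : tends (fun lam =>
    msum (B j) (fun h b => smom lam l [:: h; g] (upd B j b))) _)) => [lam lam0|].
  by rewrite /smom /=; field; exact: sqrt_neq0.
apply: tends_sum => h _; apply: tendsM; first exact: tends_cst.
(* The second moments do not depend on [lam > 0], so uniqueness of limits gives their limiting
   value. *)
have -> : (h == g)%:R = minf [:: h; g].
  apply: (tends_unique _ (minf_lim _)); apply: tends_eq (tends_cst _) => lam lam0.
  by rewrite phi_orth.
apply: (tends_shifted_moment (k := k)) => //; last exact: covered_upd_dec.
exact: leq_trans (total_upd_dec B j h) le_B.
Qed.

(** Induction on the total size: in the limit [moment_inc] becomes [limit_moment_inc], by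
    [tends_centered_moment]. *)
Lemma tends_moment B : covered B -> tends (mom^~ B) (limit_moment B).
Proof.
have [k] := ubnP (total B); elim: k B => // k IH B.
have [/total_eq0 ->|/eqP/total_neq0[C [i [g [-> lt_C]]]]] := eqVneq (total B) 0%N.
  move=> _ _; rewrite /limit_moment big1 => [|g _]; last first.
    rewrite -(pairing_moment0 n); congr pairing_moment.
    by apply: functional_extensionality => i; rewrite empty_familyE.
  apply: tends_eq (tends_cst 1) => lam lam0; rewrite /mom moment_empty //.
  - by move=> x; exact: p0.
  - exact: p1.
rewrite ltnS => le_k cB.
have gS : g \in S by apply: (cB i); rewrite upd_same inc_in.
have cC : covered C.
  move=> j x xC; apply: (cB j); rewrite /upd; case: eqP => // ji; move: xC.
  by rewrite ji !mem_finsupp incE; case: (C i x).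
have le_C : (total C <= k)%N by apply: leq_trans (ltnW lt_C) le_k.
have {}IH D : (total D <= total C)%N -> covered D -> tends (mom^~ D) (limit_moment D).
  by move=> le_D; apply: IH; apply: leq_ltn_trans le_D (leq_trans lt_C le_k).
have := tends_centered_moment [seq j <- enum 'I_n | j != i] g IH (leqnn _) cC.
rewrite limit_moment_inc // big_filter big_enum_cond; apply: tends_eq => lam lam0.
rewrite /mom moment_inc //.
- exact: sqrt_neq0.
- by move=> x; exact: p0.
- exact: p1.
by move=> G; exact: phi_summable.
Qed.

End MomentLimit.

(** * The basis on trees *)

Lemma HasSum_of_has_sum d (a : X d -> R) S : has_sum a S -> HasSum a S.
Proof.
move=> h e /RltP e0; have [s0 h0] := h e e0; exists s0 => s us ss.
by rewrite RabsE; apply/RltP; exact: h0.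
Qed.

Lemma lim_pinfty_of_tends u l : tends u l -> lim_pinfty u l.
Proof.
move=> h e /RltP e0; have [M hM] := h e e0; exists M => x /RleP Mx.
by rewrite RabsE; apply/RltP; exact: hM.
Qed.

Lemma sqrtK (x : R) : 0 <= x -> sqrt x * sqrt x = x.
Proof. by move=> /RleP; exact: sqrt_sqrt. Qed.

Lemma sqrt_gt0 (x : R) : 0 < x -> 0 < sqrt x.
Proof. by move=> /RltP x0; apply/RltP/sqrt_lt_R0. Qed.

Lemma sqrt_prod (I : Type) (s : seq I) (F : I -> R) : (forall i, 0 <= F i) ->
  sqrt (\prod_(i <- s) F i) = \prod_(i <- s) sqrt (F i).
Proof.
move=> F0; elim: s => [|i s IH]; first by rewrite !big_nil sqrt_1.
by rewrite !big_cons -IH sqrt_mult //; apply/RleP => //; exact: prodr_ge0.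
Qed.

(** The divisor is the norm of the Charlier function, by [charlier_orthogonal]. *)
Fixpoint tree_basis (lam : R) (d : nat) : X d -> X d -> R :=
  match d return X d -> X d -> R with
  | 0 => fun _ _ => 1
  | d'.+1 => fun b t =>
      charlier (sqrt lam) (bullet d') (@tree_basis lam d') b t / sqrt (family_fact b)%:R
  end.

Section TreeBasis.
Variable lam : R.
Hypothesis lam0 : 0 < lam.
Local Notation r := (sqrt lam).
Local Notation f := (tree_basis lam).

Lemma sqr_sqrt : r ^+ 2 = lam.
Proof. by rewrite expr2 sqrtK // ltW. Qed.

Lemma GW_succ d (t : X d.+1) : GW lam t = poisson_law r (@GW lam d) t.
Proof.
rewrite /poisson_law sqr_sqrt; congr (_ * _); apply: eq_bigr => a _.
by rewrite /pw RdivE RpowE INRE.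
Qed.

(** The properties carried together through the induction on depth; summability of products of any
    length is what makes the moments one level up exist. *)
Record basis_spec (d : nat) : Prop := BasisSpec {
  GW_gt0 : forall x : X d, 0 < GW lam x;
  has_sum_GW : has_sum (@GW lam d) 1;
  basis_bullet : forall x, f (bullet d) x = 1;
  basis_summable : forall G : seq (X d), summable (fun x => GW lam x * \prod_(g <- G) f g x);
  basis_orth : forall b b' : X d, has_sum (fun x => GW lam x * f b x * f b' x) (b == b')%:R;
  basis_complete : forall x y : X d, has_sum (fun b => f b x * f b y) ((x == y)%:R / GW lam x)
}.

Lemma basis_base_moment d : basis_spec d -> forall h g : X d,
  base_moment (@GW lam d) (@tree_basis lam d) [:: h; g] = (h == g)%:R.
Proof.
move=> H h g; apply/tsumE/(eq_has_sum _ (basis_orth H h g)) => x.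
by rewrite !big_cons big_nil mulr1 mulrA.
Qed.

Lemma basis_base_moment1 d : basis_spec d -> forall g : X d,
  base_moment (@GW lam d) (@tree_basis lam d) [:: g] = (g == bullet d)%:R.
Proof.
move=> H g; apply/tsumE/(eq_has_sum _ (basis_orth H g (bullet d))) => x.
by rewrite (basis_bullet H) mulr1 big_seq1.
Qed.

Definition norm_const n d (B : 'I_n -> X d.+1) : R :=
  \prod_i (sqrt (family_fact (B i))%:R)^-1.

Definition tree_moment n d (B : 'I_n -> X d.+1) : R :=
  norm_const B * moment r (@GW lam d) (bullet d) (@tree_basis lam d) B.

Lemma has_sum_tree_moment d : basis_spec d -> forall n (B : 'I_n -> X d.+1),
  has_sum (fun t : X d.+1 => GW lam t * \prod_i f (B i) t) (tree_moment B).
Proof.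
move=> H n B.
have := summable_moment (sqrt_neq0 lam0) (fun x => ltW (GW_gt0 H x)) (has_sum_GW H)
  (bullet d) (basis_summable H) B.
move=> /tsumP/(has_sumZ (norm_const B)); apply: eq_has_sum => t.
by rewrite /moment_term GW_succ mulrCA; congr (_ * _); rewrite big_split mulrC.
Qed.

Lemma basis_spec0 : basis_spec 0.
Proof.
have sum1 (a : X 0 -> R) : has_sum a (a tt).
  by have := @has_sum_fin _ a [:: tt : X 0] isT; rewrite big_seq1; apply=> -[].
split=> //.
- by move=> G; eexists; exact: sum1.
- by move=> [] []; have := sum1 (fun x => GW lam x * 1 * 1); rewrite /= !mulr1.
- by move=> [] []; have := sum1 (fun=> 1 * 1); rewrite /= divr1 mulr1.
Qed.

Lemma inv_family_fact (V : choiceType) (b : {fsfun V -> nat with 0%N}) :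
  (sqrt (family_fact b)%:R)^-1 * (sqrt (family_fact b)%:R)^-1 = ((family_fact b)%:R)^-1.
Proof. by rewrite -invfM sqrtK. Qed.

(** The law at depth [d.+1] is a Poisson family over depth [d], so each property comes from the
    general results on Poisson families. *)
Lemma basis_specS d : basis_spec d -> basis_spec d.+1.
Proof.
move=> H; have r0 := sqrt_neq0 lam0; have p0 x := ltW (GW_gt0 H x).
have GWE : @GW lam d.+1 =1 poisson_law r (@GW lam d) := @GW_succ d.
split.
- by move=> t; rewrite GWE poisson_law_gt0 //; exact: GW_gt0.
- by apply: eq_has_sum (has_sum_poisson_law r p0 (has_sum_GW H)) => t; rewrite GWE.
- by move=> t; rewrite /= charlier0 family_fact0 sqrt_1 divr1.
- move=> G; have := has_sum_tree_moment H (tnth (in_tuple G)) => h.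
  by eexists; apply: eq_has_sum h => t; rewrite [in RHS]big_tnth.
- move=> b b'; have := charlier_orthogonal r0 p0 (has_sum_GW H)
    (basis_summable H) (basis_base_moment1 H) (basis_base_moment H) b b'.
  move/(has_sumZ ((sqrt (family_fact b)%:R)^-1 / sqrt (family_fact b')%:R)).
  have -> : (sqrt (family_fact b)%:R)^-1 / sqrt (family_fact b')%:R *
      ((b == b')%:R * (family_fact b)%:R) = (b == b')%:R.
    case: eqP => [<-|_]; last by rewrite mul0r mulr0.
    by rewrite inv_family_fact mul1r mulVf // pnatr_eq0 -lt0n family_fact_gt0.
  by apply: eq_has_sum => t; rewrite GWE /=; ring.
move=> t t'; rewrite GWE.
have := charlier_complete r0 (basis_bullet H) (GW_gt0 H) (basis_complete H) t t'.
apply: eq_has_sum => b; rewrite /kernel_term /=.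
(* With constant intensity 1 the kernel weight is [1 / b!], which supplies both normalizing
   factors. *)
have -> : poisson_weight (fun=> 1) b = ((family_fact b)%:R)^-1 :> R.
  rewrite /poisson_weight /fprod /family_fact natr_prod -prodfV.
  by apply: eq_bigr => g _; rewrite expr1n mul1r.
by rewrite -inv_family_fact; ring.
Qed.

Lemma tree_basis_spec d : basis_spec d.
Proof. by elim: d => [|d IH]; [exact: basis_spec0 | exact: basis_specS]. Qed.

Lemma exp_add (x y : R) : exp (x + y) = exp x * exp y.
Proof. exact: exp_plus. Qed.

Lemma exp_neq0 (x : R) : exp x != 0.
Proof. by rewrite lt0r_neq0 //; apply/RltP/exp_pos. Qed.

(** * Expansion of the likelihood ratio *)

Section Correlation.
Variable s : R.
Hypothesis s0 : 0 <= s.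

(** Replaces the matrix sum in [Pcor] by a sum over all couplings, to which [coupling_sum_inc]
    applies. *)
Lemma Pcor_succ d : exists S : X d.+1 -> X d.+1 -> R, forall t t' : X d.+1,
  has_sum (coupling_weight (fun a => lam * (1 - s) * GW lam a)
    (fun q : X d * X d => lam * s * Pcor lam s q.1 q.2) t t') (S t t') /\
  Pcor lam s t t' = exp (- (lam * (2 - s))) * S t t'.
Proof.
eexists => t t'; split; first exact: has_sum_coupling_finite.
rewrite /=; congr (_ * _); apply: eq_bigr => M _.
by congr (_ * _ * _); apply: eq_bigr => a _; rewrite /pw RdivE RpowE INRE.
Qed.

Lemma tree_size_gt0 d (t : X d) : (0 < tree_size t)%N.
Proof. by case: d t. Qed.

(** [|b| - 1] is the sum of [|g|] over the subtrees [g] of [b], so the power of [s] factors over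
    them. *)
Lemma poisson_weight_tree_size d (b : X d.+1) :
  poisson_weight (fun g => s ^+ tree_size g) b = s ^+ (tree_size b - 1) / (family_fact b)%:R.
Proof.
rewrite subn1 /= expr_sum /family_fact natr_prod -prodfV -big_split.
by apply: eq_bigr => g _; rewrite -exprM mulnC.
Qed.

(** The likelihood ratio is checked against [has_sum_kernel] with [om g = s ^+ tree_size g] and
    [Lam = s L]: dividing the coupling recursion by the Poisson recursion of [GW] gives exactly the
    kernel recursion. *)
Lemma Lratio_succ d (H : forall x y : X d,
    has_sum (fun b : X d => s ^+ (tree_size b - 1) * f b x * f b y) (Lratio lam s x y))
  (t t' : X d.+1) :
  has_sum (fun b : X d.+1 => s ^+ (tree_size b - 1) * f b t * f b t') (Lratio lam s t t').
Proof.
have B := tree_basis_spec d; have B' := tree_basis_spec d.+1.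
have [S hS] := Pcor_succ d.
have hS1 (t1 t2 : X d.+1) := (hS t1 t2).1; have PE (t1 t2 : X d.+1) := (hS t1 t2).2.
have p_neq0 (x : X d) : GW lam x != 0 :> R by rewrite lt0r_neq0 // (GW_gt0 B).
have G_neq0 (x : X d.+1) : GW lam x != 0 :> R by rewrite lt0r_neq0 // (GW_gt0 B').
have lam_neq0 : lam != 0 by rewrite lt0r_neq0.
have succ_neq0 k : k.+1%:R != 0 :> R by rewrite pnatr_eq0.
have GI (N : X d.+1) (x : X d) :
    @GW lam d.+1 (inc N x) = lam * GW lam x * GW lam N / (N x).+1%:R.
  have := poisson_law_inc r (@GW lam d) N x; rewrite sqr_sqrt -!GW_succ => <-.
  by rewrite mulfK.
have GD (N : X d.+1) (x : X d) : x \in finsupp N ->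
    (N x)%:R / @GW lam d.+1 (dec N x) = lam * GW lam x / GW lam N.
  move=> xN; apply/eqP; rewrite eqr_div // mulrC [X in _ == X]mulrC; apply/eqP.
  have := poisson_law_dec r (@GW lam d) xN; rewrite sqr_sqrt -!GW_succ => e.
  by rewrite [RHS]mulrC e mulrC.
have S0 (N : X d.+1) : S (empty_family _) N =
    poisson_weight (fun a => lam * (1 - s) * GW lam a) N.
  exact: has_sum_unique (hS1 _ _) (has_sum_coupling_empty _ _ _).
have LE (N N' : X d.+1) : Lratio lam s N N' =
    exp (- (lam * (2 - s))) * S N N' / (GW lam N * GW lam N').
  by rewrite /Lratio PE RdivE.
have LE0 (x y : X d) : Lratio lam s x y = Pcor lam s x y / (GW lam x * GW lam y).
  by rewrite /Lratio RdivE.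
have hk := fun h1 h2 h3 h4 h5 h6 =>
  @has_sum_kernel (X d) r (bullet d) (@tree_basis lam d) (sqrt_neq0 lam0)
  (basis_bullet B) (fun g => s ^+ tree_size g) s (fun x y => s * Lratio lam s x y) h1 h2 h3
  (fun N N' => @Lratio lam s d.+1 N N') s0 h4 h5 h6 t t'.
apply: eq_has_sum (hk _ _ _ _ _ _) => [b|g||x y||N x|N N' x].
- have fE (u : X d.+1) : @tree_basis lam d.+1 b u = charlier r (bullet d) (@tree_basis lam d) b u /
      sqrt (family_fact b)%:R by [].
  rewrite /kernel_term poisson_weight_tree_size -inv_family_fact !fE.
  by move: (s ^+ _) (charlier _ _ _ _ t) (charlier _ _ _ _ t') (_^-1) => u v w z; ring.
- exact: exprn_ge0.
(* The trivial tree has size 1, so its weight is [s]. *)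
- by case: (d) => [|d'] /=; rewrite ?finsupp0 ?big_seq_fset0 expr1.
- apply: eq_has_sum (has_sumZ s (H x y)) => b.
  by rewrite !mulrA -exprS subn1 prednK // tree_size_gt0.
- rewrite LE S0 poisson_weight0 sqr_sqrt !GW_succ /poisson_law poisson_weight0 sqr_sqrt !mulr1.
  (* The exponential factors of the two [GW] cancel two copies of [exp (- lam)], leaving
     [exp (s * lam)]. *)
  have -> : - (lam * (2 - s)) = - lam + (- lam + s * lam) by ring.
  by rewrite !exp_add; field; rewrite exp_neq0.
- rewrite !LE !S0 GI.
  have -> : poisson_weight (fun a => lam * (1 - s) * GW lam a) (inc N x) =
     lam * (1 - s) * GW lam x * poisson_weight (fun a => lam * (1 - s) * GW lam a) N / (N x).+1%:R.
    by have /= <- := poisson_weight_inc (fun a => lam * (1 - s) * GW lam a) N x; rewrite mulfK.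
  by field; rewrite nat1r !(G_neq0, p_neq0, lam_neq0, succ_neq0).
rewrite !LE GI sqr_sqrt.
have -> : S (inc N x) N' = (lam * (1 - s) * GW lam x * S N N' +
   \sum_(y <- finsupp N') lam * s * Pcor lam s x y * S N (dec N' y)) / (N x).+1%:R.
  by rewrite -(coupling_sum_inc N N' x hS1) mulfK.
have -> : msum N' (fun y b => s * Lratio lam s x y * @Lratio lam s d.+1 N b) =
   exp (- (lam * (2 - s))) / (GW lam x * @GW lam d.+1 N * @GW lam d.+1 N') *
   \sum_(y <- finsupp N') lam * s * Pcor lam s x y * S N (dec N' y).
  rewrite mulr_sumr; apply: eq_big_seq => y yN; rewrite LE LE0.
  transitivity (s * (Pcor lam s x y / (GW lam x * GW lam y)) * exp (- (lam * (2 - s))) *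
     S N (dec N' y) / @GW lam d.+1 N * ((N' y)%:R / @GW lam d.+1 (dec N' y))).
    by field; rewrite !(G_neq0, p_neq0).
  by rewrite GD //; field; rewrite !(G_neq0, p_neq0).
by field; rewrite nat1r !(G_neq0, p_neq0, lam_neq0, succ_neq0).
Qed.

Lemma Lratio_expansion d (t t' : X d) :
  has_sum (fun b : X d => s ^+ (tree_size b - 1) * f b t * f b t') (Lratio lam s t t').
Proof.
elim: d t t' => [|d IH] t t'; last exact: Lratio_succ.
have := @has_sum_fin _ (fun b : X 0 => s ^+ (tree_size b - 1) * f b t * f b t') [:: tt : X 0] isT.
rewrite big_seq1 /= subnn expr0 !mulr1 /Lratio RdivE /= => h.
have -> : 1 / (1 * 1) = 1 :> R by rewrite mulr1 divr1.
by apply: h => -[].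
Qed.

End Correlation.
End TreeBasis.

(** * Limits of moments on trees *)

Section MomentAsymptotics.
Implicit Types (n d : nat).

Lemma family_fact_cover (V : choiceType) (b : {fsfun V -> nat with 0%N}) (S : seq V) :
  uniq S -> {subset finsupp b <= S} -> family_fact b = (\prod_(g <- S) (b g)`!)%N.
Proof. by move=> uS sS; apply: big_finsupp => // x ->. Qed.

Lemma supp_union_cover n d (B : 'I_n -> X d.+1) : covered (supp_union B) B.
Proof.
move=> i x xB; rewrite mem_undup; apply/flattenP.
by exists (finsupp (B i) : seq (X d)) => //; apply/mapP; exists i => //; rewrite mem_enum.
Qed.

(** Passes from the existence of limits at depth [d] to explicit limits at depth [d.+1]; the limits
    below are merely chosen, since only those of second moments enter the answer. *)
Lemma tends_tree_moment n d (B : 'I_n -> X d.+1) :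
  (forall G : seq (X d), exists l,
    tends (fun lam => base_moment (@GW lam d) (@tree_basis lam d) G) l) ->
  tends (fun lam => tree_moment lam B) (norm_const B * limit_moment (supp_union B) B).
Proof.
move=> hG; pose minf (G : seq (X d)) := ClassicalEpsilon.epsilon (inhabits 0)
  (tends (fun lam => base_moment (@GW lam d) (@tree_basis lam d) G)).
have minfP G : tends (fun lam => base_moment (@GW lam d) (@tree_basis lam d) G) (minf G).
  exact: ClassicalEpsilon.epsilon_spec.
apply: tendsM; first exact: tends_cst.
apply: (@tends_moment (X d) (bullet d) (fun lam => @GW lam d) (fun lam => @tree_basis lam d)
  minf _ _ _ _ _ minfP n (supp_union B) _ B _).
- by move=> lam x lam0; apply/ltW/(GW_gt0 (tree_basis_spec lam0 d)).
- by move=> lam lam0; apply: (has_sum_GW (tree_basis_spec lam0 d)).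
- by move=> lam x lam0; apply: (basis_bullet (tree_basis_spec lam0 d)).
- by move=> lam G lam0; apply: (basis_summable (tree_basis_spec lam0 d)).
- by move=> lam h g lam0; apply: basis_base_moment => //; exact: tree_basis_spec.
- exact: undup_uniq.
- exact: supp_union_cover.
Qed.

(** Induction on depth: a base moment at depth [d.+1] is a [tree_moment] indexed by the positions in
    [G]. At depth 0 nothing depends on [lam]. *)
Lemma base_moment_converges d (G : seq (X d)) : exists l,
  tends (fun lam => base_moment (@GW lam d) (@tree_basis lam d) G) l.
Proof.
elim: d G => [|d IH] G.
  exists (base_moment (@GW 0 0) (@tree_basis 0 0) G); apply: tends_eq (tends_cst _) => lam _.
  by congr tsum.
exists (norm_const (tnth (in_tuple G)) * limit_moment (supp_union (tnth (in_tuple G)))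
  (tnth (in_tuple G))).
apply: tends_eq (tends_tree_moment (tnth (in_tuple G)) IH) => lam lam0.
apply/esym/tsumE; apply: eq_has_sum (has_sum_tree_moment lam0 (tree_basis_spec lam0 d) _) => t.
by rewrite [in RHS]big_tnth.
Qed.

(** Redistributes the normalization over the coordinates [g]: each factorial divided by its square
    root leaves a square root. *)
Lemma limit_momentE n d (B : 'I_n -> X d.+1) :
  norm_const B * limit_moment (supp_union B) B =
  \prod_(g <- supp_union B) (sqrt (\prod_i (B i g)`!%:R) * exp_coef (fun i => B i g)).
Proof.
have uS : uniq (supp_union B) by exact: undup_uniq.
have -> : norm_const B = \prod_(g <- supp_union B) \prod_i (sqrt (B i g)`!%:R)^-1.
  rewrite exchange_big; apply: eq_bigr => i _ /=.
  rewrite (family_fact_cover uS (@supp_union_cover _ _ B i)) natr_prod sqrt_prod ?prodfV //.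
rewrite /limit_moment -big_split; apply: eq_bigr => g _ /=.
rewrite /pairing_moment mulrA; congr (_ * _).
rewrite natr_prod sqrt_prod -?big_split //; apply: eq_bigr => i _ /=.
rewrite -[X in _ * X](@sqrtK (B i g)`!%:R) // mulKf // lt0r_neq0 //.
by apply: sqrt_gt0; rewrite ltr0n fact_gt0.
Qed.

End MomentAsymptotics.

Local Open Scope R_scope.

Theorem theorem4 :
  exists f : R -> forall d : nat, X d -> X d -> R,
    (forall lam : R, 0 < lam -> forall d : nat,
       (forall s : R, 0 <= s <= 1 -> forall t t' : X d,
          HasSum (fun b : X d => s ^ (tree_size b - 1) * f lam d b t * f lam d b t')
                 (Lratio lam s t t'))
    /\ (forall t : X d, f lam d (bullet d) t = 1)
    /\ (forall b b' : X d,
          HasSum (fun t : X d => GW lam t * f lam d b t * f lam d b' t)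
                 (if b == b' then 1 else 0))
    /\ (forall t t' : X d,
          HasSum (fun b : X d => f lam d b t * f lam d b t')
                 (if t == t' then 1 / GW lam t else 0)))
  /\ (forall (n d : nat), (2 <= n)%N -> forall beta : 'I_n -> X d.+1,
        exists S : R -> R,
          (forall lam : R, 0 < lam ->
             HasSum (fun t : X d.+1 =>
                       GW lam t * \rprod_(i < n) f lam d.+1 (beta i) t) (S lam))
          /\ lim_pinfty S
               (\rprod_(g <- supp_union beta)
                  (sqrt (\rprod_(i < n) INR (factorial (beta i g)))
                   * exp_coef (fun i : 'I_n => beta i g)))).
Proof.
exists tree_basis; split=> [lam /RltP lam0 d|n d _ beta].
  have H := tree_basis_spec lam0 d; split; [|split; [|split]].
  - move=> s [/RleP s0 _] t t'; apply: HasSum_of_has_sum.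
    apply: eq_has_sum (Lratio_expansion lam0 s0 t t') => b.
    by rewrite RpowE.
  - exact: basis_bullet.
  - move=> b b'; apply: HasSum_of_has_sum.
    by have := basis_orth H b b'; case: eqP.
  - move=> t t'; apply: HasSum_of_has_sum.
    have := basis_complete H t t'; case: eqP => _; first by rewrite RdivE.
    by rewrite mul0r.
exists (fun lam => tree_moment lam beta); split.
  move=> lam /RltP lam0; apply: HasSum_of_has_sum.
  exact: has_sum_tree_moment (tree_basis_spec lam0 d) _ _.
have := lim_pinfty_of_tends (tends_tree_moment beta (@base_moment_converges d)).
rewrite limit_momentE; congr lim_pinfty; apply: eq_bigr => g _; congr (_ * _).
by congr sqrt; apply: eq_bigr => i _; rewrite INRE.
Qed.
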